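(* There is a randomized protocol, in each of the message passing model with duplication and the blackboard model with duplication, with the following property. Let $k$ be a positive integer and let $G$ be a weighted undirected distributed graph on $n$ vertices with edges observed at $s$ sites, satisfying the edge-distribution assumption (each edge $e$ resides at each of the sites, independently, with a known probability $r_e$) and with edge weights in $[1,w]$ where $w$ is polynomial in $n$. Suppose $\Upsilon_G(k)=\Omega(k^3)$ (that is, $\Upsilon_G(k)\ge C k^3$ for a suitable absolute constant $C$) and let $P_1,\dots,P_k$ be an optimal partition achieving $\rho(k)$. Then the protocol outputs at the coordinator a partition $A_1,\dots,A_k$ of $V$ such that, with probability at least $1-n^{-c}$ for a constant $c>0$, for every $i\in\{1,\dots,k\}$, $$\mathrm{vol}(A_i\,\Delta\,P_i)=O\big(k^3\,\Upsilon_G(k)^{-1}\,\mathrm{vol}(P_i)\big).$$ The communication costs in the message passing and blackboard models with duplication are $\tilde{O}(ns)$ and $\tilde{O}(n+s)$, respectively.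
   Context: Distributed graph: there are $s$ sites $S_1,\dots,S_s$; all know the common vertex set $V$, $|V|=n$, and site $S_i$ holds a subset $E_i\subseteq E$ of the edges (with their weights), where $E=\bigcup_{i=1}^s E_i$. In the duplication setting the sets $E_i$ may intersect (copies of the same edge have the same weight). Edge-distribution assumption: for each edge $e$, the probability that $e$ resides at each given site is a value $r_e$ that is known to the protocol (independently across sites). Message passing model: there is a two-way communication channel between each site and a distinguished coordinator; a site sends a message to another site by sending it to the coordinator, who forwards it. Blackboard model: sites communicate by writing messages on a shared blackboard (a broadcast channel) visible to all sites and to the coordinator. The communication cost of a protocol is the total number of bits communicated. For $S\subseteq V$: $\mathrm{vol}(S)=\mathrm{vol}_G(S)=\sum_{u\in S,v\in V}W(u,v)$ and the conductance is $\phi(S)=\phi_G(S)=\big(\sum_{u\in S,v\in V\setminus S}W(u,v)\big)/\mathrm{vol}_G(S)$, where $W(u,v)=0$ for non-edges. A ($k$-way) partition is a collection $A_1,\dots,A_k$ of pairwise disjoint vertex subsets with union $V$. The $k$-way expansion constant is $\rho(k)=\min_{A_1,\dots,A_k}\max_{1\le i\le k}\phi(A_i)$, the minimum being over all $k$-way partitions. With $L_G=D_G-A_G$ the Laplacian ($A_G$ the weighted adjacency matrix and $D_G$ the diagonal degree matrix) and $\mathcal{L}_G=D_G^{-1/2}L_GD_G^{-1/2}$ the normalized Laplacian with eigenvalues $\lambda_1\le\dots\le\lambda_n$, define $\Upsilon_G(k)=\lambda_{k+1}/\rho(k)$. The symmetric difference is $X\Delta Y=(X\setminus Y)\cup(Y\setminus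 X)$. $\tilde{O}(f)$ denotes $f$ times a polylogarithmic factor (in $n$ and $s$). *)

(* Defs.v *)
From HB Require Import structures.
From mathcomp Require Import all_boot all_order all_algebra all_fingroup.
From mathcomp Require Import all_classical all_reals all_analysis.
From mathcomp Require Import spectral complex.

Set Implicit Arguments.
Unset Strict Implicit.
Unset Printing Implicit Defensive.

Import Order.TTheory GRing.Theory Num.Theory.
Local Open Scope ring_scope.

(** * Weighted graphs, conductance, spectrum

    A weighted graph on the vertex set ['I_n] is its weighted adjacency matrix
    [W]; [W u v = 0] means that [{u, v}] is not an edge. *)

Definition weighted_graph (R : realType) (n : nat) (w : R) (W : 'M[R]_n) : Prop :=
  [/\ W^T = W,
      (forall u, W u u = 0) &
      (forall u v, W u v != 0 -> 1 <= W u v <= w)].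

(* The edge {u, v} is represented by the pair (u, v) with u < v. *)
Definition edge_set (R : realType) (n : nat) (W : 'M[R]_n) : {set 'I_n * 'I_n} :=
  [set e : 'I_n * 'I_n | (e.1 < e.2)%N && (W e.1 e.2 != 0)].

Definition vol (R : realType) (n : nat) (W : 'M[R]_n) (S : {set 'I_n}) : R :=
  \sum_(u in S) \sum_v W u v.

(* If vol S = 0 the quotient is 0 / 0 = 0. *)
Definition conductance (R : realType) (n : nat) (W : 'M[R]_n) (S : {set 'I_n}) : R :=
  (\sum_(u in S) \sum_(v in ~: S) W u v) / vol W S.

(* The parts are required to be nonempty, as the conductance of the empty set
   is undefined: with empty parts allowed, (V, set0, ..., set0) would make the
   expansion constant vanish identically. *)
Definition kway_partition (n k : nat) (A : {ffun 'I_k -> {set 'I_n}}) : bool :=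
  [&& [forall i, A i != finset.set0],
      [forall i, forall j, (i != j) ==> [disjoint A i & A j]] &
      (\bigcup_i A i)%SET == [set: 'I_n]%SET].

(* Conductances are nonnegative, so 0 is neutral for the maximum. *)
Definition max_conductance (R : realType) (n k : nat) (W : 'M[R]_n)
    (A : {ffun 'I_k -> {set 'I_n}}) : R :=
  \big[Num.max/0]_(i < k) conductance W (A i).

(* Conductances are at most 1, so 1 is neutral for the minimum; for
   0 < k <= n there is at least one k-way partition. *)
Definition expansion (R : realType) (n : nat) (W : 'M[R]_n) (k : nat) : R :=
  \big[Num.min/1]_(A : {ffun 'I_k -> {set 'I_n}} | kway_partition A)
     max_conductance W A.

Definition optimal_partition (R : realType) (n k : nat) (W : 'M[R]_n)
    (P : {ffun 'I_k -> {set 'I_n}}) : Prop :=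
  kway_partition P /\ max_conductance W P = expansion W k.

Definition degree (R : realType) (n : nat) (W : 'M[R]_n) (u : 'I_n) : R :=
  \sum_v W u v.

Definition laplacian (R : realType) (n : nat) (W : 'M[R]_n) : 'M[R]_n :=
  diag_mx (\row_u degree W u) - W.

(* At an isolated vertex the entry of D^(-1/2) is 0^-1 = 0, the usual
   convention. *)
Definition normalized_laplacian (R : realType) (n : nat) (W : 'M[R]_n) : 'M[R]_n :=
  let Dinvsqrt := diag_mx (\row_u (Num.sqrt (degree W u))^-1) in
  Dinvsqrt *m laplacian W *m Dinvsqrt.

Definition is_spectrum (R : realType) (n : nat) (A : 'M[R]_n) (l : seq R) : Prop :=
  sorted <=%R l /\ char_poly A = \prod_(x <- l) ('X - x%:P).

Lemma char_poly_conj (F : fieldType) (n : nat) (P D : 'M[F]_n) :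
  P \in unitmx -> char_poly (invmx P *m D *m P) = char_poly D.
Proof.
move=> Pu; rewrite /char_poly /char_poly_mx !map_mxM /=.
set Q := map_mx polyC P; set Q' := map_mx polyC (invmx P).
have QQ : Q' *m Q = 1%:M by rewrite -map_mxM mulVmx // map_mx1.
have -> : 'X%:M - Q' *m map_mx polyC D *m Q = Q' *m ('X%:M - map_mx polyC D) *m Q.
  by rewrite mulmxBr mulmxBl scalar_mxC -[_ *m Q' *m Q]mulmxA QQ mulmx1.
by rewrite !det_mulmx mulrAC -det_mulmx QQ det1 mul1r.
Qed.

Lemma symmetric_is_spectrum (R : realType) (n : nat) (A : 'M[R]_n) :
  A^T = A -> exists l, is_spectrum A l.
Proof.
move=> At; pose B : 'M[R[i]]_n := map_mx (real_complex R) A.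
have Bherm : B \is hermsymmx.
  apply: realsym_hermsym.
    by apply/is_hermitianmxP; rewrite expr0 scale1r map_mx_id // map_trmx At.
  by apply/mxOverP => i j; rewrite mxE; apply/complex_realP; exists (A i j).
have spR := hermitian_spectral_diag_real Bherm.
have /orthomx_spectralP Beq := hermitian_normalmx Bherm.
pose d i : R := complex.Re (spectral_diag B 0 i).
exists (sort <=%R [seq d i | i <- enum 'I_n]); split.
  by apply: sort_sorted; apply: le_total.
apply: (map_poly_inj (real_complex R)).
rewrite map_char_poly -/B [in LHS]Beq char_poly_conj ?spectral_unit //.
rewrite char_poly_trig ?diag_mx_is_trig //.
rewrite (perm_big _ (permEl (perm_sort _ _))) /= big_map big_enum /=.
rewrite rmorph_prod; apply: eq_bigr => i _ /=.
rewrite rmorphB /= map_polyX map_polyC /= mxE eqxx mulr1n.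
by congr ('X - _%:P); rewrite /d RRe_real //; apply: (mxOverP spR).
Qed.

(* The eigenvalues with multiplicity, in nondecreasing order; they
   exist for symmetric [A] by [symmetric_is_spectrum]. *)
Definition eigenvalues (R : realType) (n : nat) (A : 'M[R]_n) : seq R :=
  xget [::] [set l | is_spectrum A l]%classic.

(* lambda_(k+1) / rho(k), with lambda_1 the eigenvalue of index 0. In [\bar R]
   one has 0^-1 = +oo, +oo^-1 = 0 and 0 * +oo = 0, so the value is +oo if
   rho(k) = 0 < lambda_(k+1), and 0 if both vanish. *)
Definition upsilon (R : realType) (n : nat) (W : 'M[R]_n) (k : nat) : \bar R :=
  ((nth 0 (eigenvalues (normalized_laplacian W)) k)%:E / (expansion W k)%:E)%E.

Definition symdiff (n : nat) (X Y : {set 'I_n}) : {set 'I_n} :=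
  ((X :\: Y) :|: (Y :\: X))%SET.

(* The parts of the computed partition carry no canonical numbering, whence the
   permutation [sg]. *)
Definition close_partition (R : realType) (n k : nat) (W : 'M[R]_n) (c : R)
    (A P : {ffun 'I_k -> {set 'I_n}}) : bool :=
  [exists sg : 'S_k, [forall i,
     ((vol W (symdiff (A (sg i)) (P i)))%:E
       <= (c * k%:R ^+ 3)%:E * (upsilon W k)^-1 * (vol W (P i))%:E)%E]].

(** * Distribution of the edges among the sites *)

(* [D i] is the set of edges held by site [i]; the sets may overlap. *)
Notation placement n s := {ffun 'I_s -> {set 'I_n * 'I_n}}.

(* The edge set of a distributed graph is the union of the local ones, so the
   random placement below is to be conditioned on this event. *)
Definition covers (R : realType) (n s : nat) (W : 'M[R]_n) (D : placement n s) : bool :=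
  (\bigcup_i D i)%SET == edge_set W.

Definition local_graph (R : realType) (n s : nat) (W : 'M[R]_n) (D : placement n s)
    (i : 'I_s) : 'M[R]_n :=
  \matrix_(u, v) (if ((u, v) \in D i) || ((v, u) \in D i) then W u v else 0).

(* Before conditioning, each edge e lies in each [D i] independently with probability r_e. *)
Definition placement_pmf (R : realType) (n s : nat) (r : 'I_n * 'I_n -> R)
    (W : 'M[R]_n) (D : placement n s) : R :=
  if [forall i, D i \subset edge_set W] then
    \prod_i \prod_(e in edge_set W) (if e \in D i then r e else 1 - r e)
  else 0.

(** * Randomized protocols

    A party is [Some i], the i-th site, or [None], the coordinator. Local
    computation is unrestricted. *)

(* Every party has private random coins, independent of those of the others. *)
Record private_coins (R : realType) (s : nat) := PrivateCoins {
  coin : finType;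
  coin_pmf : option 'I_s -> coin -> R;
  coin_pmf_ge0 : forall p x, 0 <= coin_pmf p x;
  coin_pmf_sum1 : forall p, \sum_x coin_pmf p x = 1
}.

Notation outcome C s := {ffun option 'I_s -> coin C}.

Definition outcome_pmf (R : realType) (s : nat) (C : private_coins R s)
    (om : outcome C s) : R :=
  \prod_p coin_pmf p (om p).

(* Joint law of the placement of the edges and of the coins. *)
Definition Pr (R : realType) (n s : nat) (r : 'I_n * 'I_n -> R) (W : 'M[R]_n)
    (C : private_coins R s) (ev : placement n s -> outcome C s -> bool) : R :=
  \sum_D \sum_om placement_pmf r W D * outcome_pmf om * (ev D om)%:R.

(** ** Message passing model

    Each site shares a two-way channel with the coordinator. At every step the
    coordinator, knowing its own coins and the bits exchanged so far on all the
    channels, stops or selects a channel, on which one bit is transmitted. The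
    bits already exchanged on that channel determine which end speaks, so that
    no information is conveyed by silence; a bit sent by a site depends only on
    the input and the coins of the site and on its own channel. *)
Record mp_protocol (R : realType) (n s : nat) (Out : Type) := MPProtocol {
  mp_coins : private_coins R s;
  mp_steps : nat;
  mp_select : coin mp_coins -> {ffun 'I_s -> seq bool} -> option 'I_s;
  mp_site_speaks : 'I_s -> seq bool -> bool;
  mp_site_bit : 'I_s -> 'M[R]_n -> coin mp_coins -> seq bool -> bool;
  mp_coord_bit : coin mp_coins -> {ffun 'I_s -> seq bool} -> bool;
  mp_decide : coin mp_coins -> {ffun 'I_s -> seq bool} -> Out
}.

Definition mp_step (R : realType) (n s : nat) (Out : Type)
    (pi : mp_protocol R n s Out) (x : 'I_s -> 'M[R]_n)
    (om : outcome (mp_coins pi) s) (h : {ffun 'I_s -> seq bool}) :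
    {ffun 'I_s -> seq bool} :=
  if mp_select (om None) h is Some i then
    let b := if mp_site_speaks pi i (h i)
             then mp_site_bit i (x i) (om (Some i)) (h i)
             else mp_coord_bit (om None) h in
    [ffun j => if j == i then rcons (h j) b else h j]
  else h.

Definition mp_run (R : realType) (n s : nat) (Out : Type)
    (pi : mp_protocol R n s Out) (x : 'I_s -> 'M[R]_n)
    (om : outcome (mp_coins pi) s) : {ffun 'I_s -> seq bool} :=
  iter (mp_steps pi) (mp_step x om) [ffun=> [::]].

Arguments mp_run {R n s Out} pi x om.

Definition mp_cost (R : realType) (n s : nat) (Out : Type)
    (pi : mp_protocol R n s Out) (x : 'I_s -> 'M[R]_n)
    (om : outcome (mp_coins pi) s) : nat :=
  (\sum_i size (mp_run pi x om i))%N.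

Definition mp_output (R : realType) (n s : nat) (Out : Type)
    (pi : mp_protocol R n s Out) (x : 'I_s -> 'M[R]_n)
    (om : outcome (mp_coins pi) s) : Out :=
  mp_decide (om None) (mp_run pi x om).

Arguments mp_cost {R n s Out} pi x om.
Arguments mp_output {R n s Out} pi x om.

(** ** Blackboard model

    All parties see the sequence of bits written on the board. This sequence
    determines whether the protocol stops, and otherwise which party writes the
    next bit. *)
Record bb_protocol (R : realType) (n s : nat) (Out : Type) := BBProtocol {
  bb_coins : private_coins R s;
  bb_steps : nat;
  bb_turn : seq bool -> option (option 'I_s);
  bb_site_bit : 'I_s -> 'M[R]_n -> coin bb_coins -> seq bool -> bool;
  bb_coord_bit : coin bb_coins -> seq bool -> bool;
  bb_decide : coin bb_coins -> seq bool -> Out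
}.

Definition bb_step (R : realType) (n s : nat) (Out : Type)
    (pi : bb_protocol R n s Out) (x : 'I_s -> 'M[R]_n)
    (om : outcome (bb_coins pi) s) (h : seq bool) : seq bool :=
  match bb_turn pi h with
  | None => h
  | Some None => rcons h (bb_coord_bit (om None) h)
  | Some (Some i) => rcons h (bb_site_bit i (x i) (om (Some i)) h)
  end.

Definition bb_run (R : realType) (n s : nat) (Out : Type)
    (pi : bb_protocol R n s Out) (x : 'I_s -> 'M[R]_n)
    (om : outcome (bb_coins pi) s) : seq bool :=
  iter (bb_steps pi) (bb_step x om) [::].

Arguments bb_run {R n s Out} pi x om.

Definition bb_cost (R : realType) (n s : nat) (Out : Type)
    (pi : bb_protocol R n s Out) (x : 'I_s -> 'M[R]_n)
    (om : outcome (bb_coins pi) s) : nat :=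
  size (bb_run pi x om).

Definition bb_output (R : realType) (n s : nat) (Out : Type)
    (pi : bb_protocol R n s Out) (x : 'I_s -> 'M[R]_n)
    (om : outcome (bb_coins pi) s) : Out :=
  bb_decide (om None) (bb_run pi x om).

Arguments bb_cost {R n s Out} pi x om.
Arguments bb_output {R n s Out} pi x om.

(* Main.v *)
Require Import Defs.
From HB Require Import structures.
From mathcomp Require Import all_boot all_order all_algebra all_fingroup.
From mathcomp Require Import all_classical all_reals all_analysis.
From mathcomp Require sesquilinear spectral complex.
From mathcomp Require Import ring lra zify.

(** The coordinator only needs to know all cuts of [W] up to a constant factor.

    Cuts determine a good partition: let [lambda] be the [(k+1)]-st eigenvalue
    and [rho] the expansion constant.  The normalized indicator of a set [S] has
    Rayleigh quotient at most its conductance, hence lies within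
    [sqrt (conductance S / lambda)] of the span of the bottom [k] eigenvectors.
    For two [k]-way partitions with all conductances [O(rho)] both families of
    indicators almost span this space, so each indicator of the first family is
    almost in the span of the second one, and this forces the parts to match up
    to volumes [O(k rho / lambda) vol (P i)].  Hence it suffices to output a
    partition minimizing an approximation of the maximal conductance.

    Cuts are learned by a sparsifier insensitive to duplication.  Edges are
    sifted, site after site, through levels of [t] forests: an edge joining two
    components of a forest is posted there, an edge rejected by all forests of
    a level goes on to the next level iff a public coin attached to the edge and
    the level says so; an edge posted at level [l] counts [2^l] times.  A cut of
    the edges rejected by a level is determined by its trace [J] on any forest of
    this level; choosing the forest where [#|J|] is least, the cut has at least
    [t * #|J|] edges in the level.  There are at most [n^#|J|] such traces, so a
    Chernoff bound beats the union bound.  Weights are handled by placing the edges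
    with weight in [[2^j, 2^(j+1))] on the [j]-th copy of the vertex set.

    Since only the edges that are posted need to be communicated and there are few
    of them, it remains to provide the public coins: by Newman's argument a fixed
    list of polynomially many seeds is good for all inputs, so the coordinator only
    has to announce the index of a seed. *)

Set Implicit Arguments.
Unset Strict Implicit.
Unset Printing Implicit Defensive.

Import Order.TTheory GRing.Theory Num.Theory.
Local Open Scope ring_scope.

(** * Sifting edges through spanning forests *)

Section Forest.
Local Open Scope nat_scope.
Variable V : finType.
Implicit Types (e : V * V) (F s : seq (V * V)) (S : {set V}).

Definition crosses S e : bool := (e.1 \in S) (+) (e.2 \in S).

(** A representative of the component of [x] in the graph with edge list [F]: prepending [e]
    redirects the class of [e.1] to the representative of [e.2]. *)
Fixpoint comp_label F (x : V) : V :=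
  if F is e :: F' then
    if comp_label F' x == comp_label F' e.1 then comp_label F' e.2
    else comp_label F' x
  else x.

Definition joined F e : bool := comp_label F e.1 == comp_label F e.2.

(** This replaces a theory of paths: connectivity is exploited only through predicates that are
    constant along edges. *)
Lemma comp_label_invariant F (Z : pred V) :
  {in F, forall e, Z e.1 = Z e.2} -> forall x, Z (comp_label F x) = Z x.
Proof.
elim: F => //= e F IHF ZF x.
have {}IHF : forall y, Z (comp_label F y) = Z y.
  by apply: IHF => f fF; apply: ZF; rewrite inE fF orbT.
case: eqP => [ex|_]; last exact: IHF.
by rewrite IHF -(ZF e (mem_head _ _)) -IHF -ex IHF.
Qed.

Lemma joined_invariant F (Z : pred V) e :
  {in F, forall f, Z f.1 = Z f.2} -> joined F e -> Z e.1 = Z e.2.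
Proof.
by move=> ZF /eqP je; rewrite -(comp_label_invariant ZF e.1) je comp_label_invariant.
Qed.

Lemma joined_cons F e f : joined F e -> joined (f :: F) e.
Proof. by move=> /eqP je; rewrite /joined /= je. Qed.

Lemma joined_head F e : joined (e :: F) e.
Proof. by rewrite /joined /= eqxx; case: ifP => // /eqP. Qed.

Lemma joined_mem F e : e \in F -> joined F e.
Proof.
elim: F => //= f F IHF; rewrite inE => /orP[/eqP->|/IHF]; last exact: joined_cons.
exact: joined_head.
Qed.

(* No edge of [F] leaves the symmetric difference of [S] and [S'], which is
   therefore a union of components. *)
Lemma crosses_determined F S S' e :
  {in F, crosses S =1 crosses S'} -> joined F e -> crosses S e = crosses S' e.
Proof.
move=> SS' je.
have h : {in F, forall f, (f.1 \in S) (+) (f.1 \in S') = (f.2 \in S) (+) (f.2 \in S')}.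
  move=> f /SS'; rewrite /crosses.
  by do 4!case: (_ \in _).
move: (@joined_invariant F (fun x => (x \in S) (+) (x \in S')) e h je).
rewrite /crosses.
by do 4!case: (_ \in _).
Qed.

Fixpoint forest F : bool :=
  if F is e :: F' then ~~ joined F' e && forest F' else true.

(** An edge joining two components makes the label of its first end disappear, so the number of
    edges plus the number of labels never exceeds [#|V|]. *)
Lemma forest_size F : forest F -> size F <= #|V|.
Proof.
suff : forest F -> size F + #|[set comp_label F x | x : V]| <= #|V|.
  by move=> h /h; apply: leq_trans; apply: leq_addr.
elim: F => /= [_|e F IHF /andP[ne /IHF le_F]]; first by rewrite max_card.
apply: leq_trans le_F; rewrite addSnnS leq_add2l.
rewrite [X in _ < X](cardsD1 (comp_label F e.1)) imset_f // add1n ltnS.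
apply: subset_leq_card; apply/fintype.subsetP => _ /imsetP[x _ ->].
rewrite !inE; case: ifPn => [_|->]; last by rewrite imset_f.
by rewrite imset_f // andbT eq_sym.
Qed.

Definition grow F e := if joined F e then F else e :: F.

Definition grown s := foldl grow [::] s.

(** The rejected edges. A copy of an edge already held by the forest is absorbed rather than
    rejected, which makes duplicated edges harmless. *)
Fixpoint overflow F s :=
  if s is e :: s' then
    if joined F e && (e \notin F) then e :: overflow F s'
    else overflow (grow F e) s'
  else [::].

Lemma forest_grow F e : forest F -> forest (grow F e).
Proof. by rewrite /grow; case: ifPn => //= -> ->. Qed.

Lemma forest_foldl_grow F s : forest F -> forest (foldl grow F s).
Proof. by elim: s F => //= e s IHs F /(forest_grow e); apply: IHs. Qed.

Lemma forest_grown s : forest (grown s).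
Proof. exact: forest_foldl_grow. Qed.

Lemma sub_grow F e : {subset F <= grow F e}.
Proof. by move=> x xF; rewrite /grow; case: ifP => //; rewrite inE xF orbT. Qed.

Lemma sub_foldl_grow F s : {subset F <= foldl grow F s}.
Proof. by elim: s F => [|e s IHs] F x //= /(@sub_grow F e); apply: IHs. Qed.

Lemma foldl_grow_sub F s : {subset foldl grow F s <= F ++ s}.
Proof.
elim: s F => [F x|e s IHs F x /IHs]; first by rewrite cats0.
rewrite !mem_cat inE /grow; case: ifP => _; first by case/orP=> ->; rewrite ?orbT.
by rewrite inE; case: (x == e); case: (x \in F); rewrite ?orbT.
Qed.

Lemma sub_grown s : {subset grown s <= s}.
Proof. exact: foldl_grow_sub. Qed.

Lemma joined_grow F e f : joined F e -> joined (grow F f) e.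
Proof. by rewrite /grow; case: ifP => // _; apply: joined_cons. Qed.

Lemma joined_foldl_grow F s e : joined F e -> joined (foldl grow F s) e.
Proof. by elim: s F => //= f s IHs F /(joined_grow f); apply: IHs. Qed.

Lemma notin_foldl_grow F s e :
  joined F e -> e \notin F -> e \notin foldl grow F s.
Proof.
elim: s F => //= f s IHs F jF eF; apply: IHs; first exact: joined_grow.
rewrite /grow; case: ifPn => // njf; rewrite inE negb_or eF andbT.
by apply: contraNneq njf => <-.
Qed.

Lemma mem_grow_self F e : ~~ (joined F e && (e \notin F)) -> e \in grow F e.
Proof. by rewrite negb_and negbK /grow; case: ifP => //= _ _; rewrite inE eqxx. Qed.

(** [overflow] tests against the growing forest, yet the final one decides: a rejected edge has its
    ends joined already and is never added later. *)
Lemma mem_overflow F s e :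
  (e \in overflow F s) = (e \in s) && (e \notin foldl grow F s).
Proof.
elim: s F => //= f s IHs F; case: ifPn => [/andP[jf fF]|nf].
  have -> : grow F f = F by rewrite /grow jf.
  rewrite !inE IHs; have [->|] //= := eqVneq e f.
  by rewrite notin_foldl_grow.
rewrite IHs inE; have [->|//] := eqVneq e f.
by rewrite /= (sub_foldl_grow s (mem_grow_self nf)) andbF.
Qed.

Lemma joined_grown s e : e \in s -> joined (grown s) e.
Proof.
rewrite /grown; elim: s [::] => //= f s IHs F; rewrite inE => /orP[/eqP->|].
  apply: joined_foldl_grow; rewrite /grow; case: ifP => // _; exact: joined_head.
exact: IHs.
Qed.

(** An edge travels until a slot absorbs it or [kappa] drops it after a rejection. Shifting [kappa]
    keeps the current slot at index [0]. *)
Fixpoint sift (kappa : nat -> pred (V * V)) (Fs : seq (seq (V * V))) e :=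
  if Fs is F :: Fs' then
    if joined F e && (e \notin F) then
      F :: (if kappa 0 e then sift (fun q => kappa q.+1) Fs' e else Fs')
    else grow F e :: Fs'
  else [::].

Fixpoint arrivals (kappa : nat -> pred (V * V)) s q : seq (V * V) :=
  if q is q'.+1 then
    arrivals (fun p => kappa p.+1) [seq e <- overflow [::] s | kappa 0 e] q'
  else s.

Lemma arrivalsS kappa s q :
  arrivals kappa s q.+1 = [seq e <- overflow [::] (arrivals kappa s q) | kappa q e].
Proof. by elim: q kappa s => //= q IHq kappa s; rewrite -IHq. Qed.

Lemma foldl_sift_cons kappa F Fs s :
  foldl (sift kappa) (F :: Fs) s =
  foldl grow F s :: foldl (sift (fun q => kappa q.+1)) Fs
                          [seq e <- overflow F s | kappa 0 e].
Proof.
elim: s F Fs => //= e s IHs F Fs; case: ifP => [/andP[je eF]|_]; rewrite IHs //.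
by rewrite /= /grow je; case: ifP.
Qed.

Lemma foldl_sift_nil kappa s : foldl (sift kappa) [::] s = [::].
Proof. by elim: s. Qed.

(** Processing edge by edge and processing slot by slot agree, since a slot is affected only by the
    subsequence of edges that reach it. *)
Lemma foldl_siftE kappa s Q :
  foldl (sift kappa) (nseq Q [::]) s =
  mkseq (fun q => grown (arrivals kappa s q)) Q.
Proof.
elim: Q kappa s => [|Q IHQ] kappa s; first exact: foldl_sift_nil.
by rewrite /= foldl_sift_cons IHQ /mkseq /= -[1]addn0 iotaDl -map_comp.
Qed.

Lemma size_sift kappa Fs e : size (sift kappa Fs e) = size Fs.
Proof. by elim: Fs kappa => //= F Fs IHFs kappa; case: ifP => _ //=; case: ifP; rewrite /= ?IHFs. Qed.

Lemma all_forest_sift kappa Fs e : all forest Fs -> all forest (sift kappa Fs e).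
Proof.
elim: Fs kappa => //= F Fs IHFs kappa /andP[fF fFs].
case: ifP => _ /=; last by rewrite forest_grow.
by rewrite fF; case: ifP => //= _; apply: IHFs.
Qed.

Definition total_size (Fs : seq (seq (V * V))) := sumn (map size Fs).

Lemma total_size_le Fs : all forest Fs -> total_size Fs <= size Fs * #|V|.
Proof.
rewrite /total_size.
by elim: Fs => //= F Fs IHFs /andP[/forest_size fF /IHFs]; rewrite mulSn; apply: leq_add.
Qed.

(** At most one slot changes, and it gains one edge; hence [total_size] counts the edges that have
    to be communicated. *)
Lemma total_size_sift kappa Fs e :
  sift kappa Fs e != Fs -> total_size (sift kappa Fs e) = (total_size Fs).+1.
Proof.
rewrite /total_size; elim: Fs kappa => //= F Fs IHFs kappa; case: ifP => [_|_].
  rewrite eqseq_cons eqxx /=; case: ifP => [_ /IHFs->|_]; last by rewrite eqxx.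
  by rewrite addnS.
by rewrite eqseq_cons eqxx andbT /grow; case: ifP; rewrite ?eqxx.
Qed.

Lemma sift_self kappa Fs e : sift kappa (sift kappa Fs e) e = sift kappa Fs e.
Proof.
elim: Fs kappa => //= F Fs IHFs kappa; case: ifPn => [c|c] /=.
  by rewrite c; case k0: (kappa 0 e); rewrite // IHFs.
rewrite mem_grow_self // andbF /=; congr (_ :: _).
have je : joined (grow F e) e by rewrite /grow; case: ifP => // _; exact: joined_head.
by rewrite {1}/grow je.
Qed.

(** A slot that rejected [e] still rejects it and a slot holding [e] still holds it, so an edge
    without effect may be skipped for good. *)
Lemma sift_stable kappa Fs e f :
  sift kappa Fs e = Fs -> sift kappa (sift kappa Fs f) e = sift kappa Fs f.
Proof.
elim: Fs kappa => //= F Fs IHFs kappa; case: (boolP (joined F e && (e \notin F))) => c.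
  case=> h; case: (boolP (joined F f && (f \notin F))) => cf /=.
    rewrite c; congr (_ :: _); case: ifP => [k0|//]; rewrite k0 in h.
    by case: ifP => // _; apply: IHFs.
  have [jF eF] := andP c.
  have cg : joined (grow F f) e && (e \notin grow F f).
    by rewrite joined_grow // (notin_foldl_grow [:: f] jF eF).
  by rewrite cg h.
case=> /esym gF; have eF : e \in F by rewrite gF; apply: mem_grow_self.
case: (boolP (joined F f && (f \notin F))) => cf /=.
  by rewrite (negbTE c) -gF.
have eG : e \in grow F f by apply: sub_grow.
by rewrite eG andbF /= {1}/grow (joined_mem eG).
Qed.

Fixpoint effective kappa Fs s :=
  if s is e :: s' then
    if sift kappa Fs e == Fs then effective kappa Fs s'
    else e :: effective kappa (sift kappa Fs e) s'
  else [::].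

Lemma foldl_sift_effective kappa Fs s :
  foldl (sift kappa) Fs (effective kappa Fs s) = foldl (sift kappa) Fs s.
Proof.
elim: s Fs => //= e s IHs Fs; case: eqP => [eFs|_] /=; last exact: IHs.
by rewrite IHs eFs.
Qed.

Lemma total_size_effective kappa Fs s :
  total_size (foldl (sift kappa) Fs s) = total_size Fs + size (effective kappa Fs s).
Proof.
elim: s Fs => [Fs|e s IHs Fs] /=; first by rewrite addn0.
rewrite IHs; case: eqVneq => [->//|/total_size_sift->].
by rewrite /= addSnnS.
Qed.

Lemma all_forest_foldl_sift kappa Fs s :
  all forest Fs -> all forest (foldl (sift kappa) Fs s).
Proof. by elim: s Fs => //= e s IHs Fs /(all_forest_sift kappa e); apply: IHs. Qed.

Lemma size_foldl_sift kappa Fs s : size (foldl (sift kappa) Fs s) = size Fs.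
Proof. by elim: s Fs => //= e s IHs Fs; rewrite IHs size_sift. Qed.

End Forest.

(** * Sampling the rejected edges *)

Section Chernoff.
Variable R : realType.

Lemma expR_le_quadratic (x : R) : x <= 2^-1 -> expR x <= 1 + x + 2 * x ^+ 2.
Proof.
move=> x_le; have h : 1 - x <= expR (- x) by apply: expR_ge1Dx.
have x1 : 0 < 1 - x by lra.
have : expR x <= (1 - x)^-1.
  by rewrite -[expR x]invrK -expRN lef_pV2 // posrE // expR_gt0.
move=> /le_trans; apply; rewrite -[leLHS]mul1r ler_pdivrMr //.
(* The product of the two factors is [1 + x ^+ 2 * (1 - 2 * x)]. *)
nra.
Qed.

Lemma sum_expR_le (x : R) : - 2^-1 <= x <= 2^-1 ->
  expR x + expR (- x) <= 2 * expR (2 * x ^+ 2).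
Proof.
move=> /andP[x1 x2].
have h1 := expR_le_quadratic x2.
have h2 : expR (- x) <= 1 + (- x) + 2 * (- x) ^+ 2 by apply: expR_le_quadratic; lra.
have h3 : 1 + 2 * x ^+ 2 <= expR (2 * x ^+ 2) by apply: expR_ge1Dx.
rewrite sqrrN in h2; lra.
Qed.

Variable E : finType.

(** The error made when each kept edge of [Q] counts twice; under uniform coins it is a sum of
    independent signs. *)
Definition deviation (Q : {set E}) (x : {ffun E -> bool}) : R :=
  2 * #|[set e in Q | x e]|%:R - #|Q|%:R.

Lemma deviationE (Q : {set E}) (x : {ffun E -> bool}) :
  deviation Q x = \sum_e (if e \in Q then (-1) ^+ (~~ x e) else 0).
Proof.
rewrite /deviation -big_mkcond /= -sum1_card -sum1_card !natr_sum.
rewrite [in X in 2 * X](eq_bigl (fun e => (e \in Q) && x e)); last by move=> e; rewrite inE.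
rewrite big_mkcondr /= mulr_sumr -sumrB; apply: eq_bigr => e _.
by case: (x e); rewrite ?expr0 ?expr1; lra.
Qed.

(** Expectations are written as sums over all coin assignments, whence the factor [2 ^+ #|E|];
    independence is the exchange of sum and product. *)
Lemma mgf_deviation (Q : {set E}) (a : R) : - 2^-1 <= a <= 2^-1 ->
  \sum_x expR (a * deviation Q x) <= 2 ^+ #|E| * expR (2 * a ^+ 2 * #|Q|%:R).
Proof.
move=> a_le.
pose f e (b : bool) : R := if e \in Q then expR (a * (-1) ^+ (~~ b)) else 1.
have -> : \sum_x expR (a * deviation Q x) = \sum_(x : {ffun E -> bool}) \prod_e f e (x e).
  apply: eq_bigr => x _; rewrite deviationE mulr_sumr expR_sum.
  by apply: eq_bigr => e _; rewrite /f; case: ifP => // _; rewrite mulr0 expR0.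
rewrite -(bigA_distr_bigA f).
have -> : 2 ^+ #|E| * expR (2 * a ^+ 2 * #|Q|%:R) =
  \prod_e (2 * (if e \in Q then expR (2 * a ^+ 2) else 1)).
  rewrite big_split /= prodr_const; congr (_ * _).
  by rewrite -big_mkcond /= prodr_const expRM_natr.
apply: ler_prod => e _; rewrite big_bool /f /=; case: (e \in Q); last first.
  by apply/andP; split; lra.
rewrite expr0 expr1 mulrN !mulr1 addr_ge0 ?expR_ge0 //=.
exact: sum_expR_le.
Qed.

(* Markov's inequality for [expR (+/- (eps / 2) * deviation)]. *)
Lemma chernoff (Q : {set E}) (eps a : R) : 0 <= eps <= 1 ->
  \sum_x (eps * (#|Q|%:R + a) < `|deviation Q x|)%R%:R <=
  2 * expR (- (eps ^+ 2 * a / 2)) * 2 ^+ #|E|.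
Proof.
move=> /andP[e0 e1].
pose c := expR (- (eps / 2 * (eps * (#|Q|%:R + a)))).
apply: (@le_trans _ _ (\sum_x (c * expR (eps / 2 * deviation Q x)
                              + c * expR (- (eps / 2) * deviation Q x)))).
  apply: ler_sum => x _; rewrite /c -!expRD.
  have [dev|_] /= := ltP; last by rewrite addr_ge0 // expR_ge0.
  have [d0|d0] := leP 0 (deviation Q x).
    apply: (@le_trans _ _ (1 + 0)); first by rewrite addr0.
    apply: lerD; last exact: expR_ge0.
    rewrite ger0_norm // in dev; rewrite -[leLHS](@expR0 R) ler_expR addrC -mulrBr.
    by apply: mulr_ge0; lra.
  apply: (@le_trans _ _ (0 + 1)); first by rewrite add0r.
  apply: lerD; first exact: expR_ge0.
  rewrite ltr0_norm // in dev; rewrite -[leLHS](@expR0 R) ler_expR addrC mulNr -mulrN -mulrBr.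
  by apply: mulr_ge0; lra.
rewrite big_split /= -!mulr_sumr -mulrDr.
have m1 := @mgf_deviation Q (eps / 2) _; have m2 := @mgf_deviation Q (- (eps / 2)) _.
rewrite sqrrN in m2.
apply: le_trans (_ : c * (2 ^+ #|E| * expR (2 * (eps / 2) ^+ 2 * #|Q|%:R) *+ 2) <= _).
  rewrite ler_pM2l ?expR_gt0 // mulr2n lerD //.
  - by apply: m1; apply/andP; split; lra.
  - by apply: m2; apply/andP; split; lra.
(* At slope [eps / 2] the two terms in [#|Q|] cancel, so that only the additive slack [a] remains in
   the exponent. *)
have -> : expR (- (eps ^+ 2 * a / 2)) = c * expR (2 * (eps / 2) ^+ 2 * #|Q|%:R).
  by rewrite -expRD; congr expR; field.
by rewrite le_eqVlt; apply/orP; left; apply/eqP; ring.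
Qed.

End Chernoff.

(** * Union bound over the cuts of one level *)

Section UnionBound.
Variables (R : realType) (V : finType).

Lemma sum_subsets (T : finType) (A : {set T}) (y : R) :
  \sum_(J : {set T} | J \subset A) y ^+ #|J| = (1 + y) ^+ #|A|.
Proof.
rewrite addrC -prodr_const.
have -> : \prod_(i in A) (y + 1) = \prod_i ((if i \in A then y else 0) + 1).
  by rewrite big_mkcond; apply: eq_bigr => i _; case: ifP; rewrite ?add0r.
rewrite bigA_distr big_mkcond; apply: eq_bigr => J _ /=.
rewrite -big_mkcond /=; case: ifPn => [/fintype.subsetP JA|/fintype.subsetPn[i iJ iA]].
  by rewrite -prodr_const; apply: eq_bigr => i /JA ->.
by rewrite (bigD1 i) //= (negbTE iA) mul0r.
Qed.

Lemma exprD1_le (y : R) (n : nat) : 0 <= y -> n%:R * y <= 2^-1 ->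
  (1 + y) ^+ n <= 1 + 2 * n%:R * y.
Proof.
move=> y0 ny; apply: (@le_trans _ _ (expR (n%:R * y))).
  rewrite mulrC expRM_natr; apply: lerXn2r; rewrite ?nnegrE ?expR_ge0 ?addr_ge0 //.
  exact: expR_ge1Dx.
apply: le_trans (expR_le_quadratic ny) _.
have : 0 <= n%:R * y by apply: mulr_ge0.
nra.
Qed.

Definition cut_edges (Q : {set V * V}) (S : {set V}) : {set V * V} :=
  [set e in Q | crosses S e].

Variables (t m : nat) (Fs : nat -> seq (V * V)) (Q : {set V * V}) (eps : R).
Hypotheses (t_gt0 : (0 < t)%N) (eps01 : 0 <= eps <= 1).
Hypothesis Fs_size : forall i, (i < t)%N -> (size (Fs i) <= m)%N.
Hypothesis Q_joined : forall e i, e \in Q -> (i < t)%N -> joined (Fs i) e.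
Let y : R := expR (- (eps ^+ 2 * t%:R / 2)).
Hypothesis y_small : m%:R * y <= 2^-1.

(** The tolerated error is relative to all cut edges of the level, those held by its forests
    included; the latter supply the slack for the union bound. *)
Definition badly_sampled (x : {ffun V * V -> bool}) : bool :=
  [exists S : {set V},
    eps * (#|cut_edges Q S|%:R + (\sum_(i < t) #|cut_edges [set e in Fs i] S|)%:R)
    < `|deviation R (cut_edges Q S) x|].

(* A cut meeting [Q] meets each forest; the cut edges of the forest it meets
   least determine the cut edges in [Q]. *)
Lemma badly_sampled_le :
  \sum_x (badly_sampled x)%:R <= 4 * t%:R * m%:R * y * 2 ^+ #|{: V * V}|.
Proof.
pose trace i S := cut_edges [set e in Fs i] S.
have Qdet i S S' : (i < t)%N -> trace i S = trace i S' -> cut_edges Q S = cut_edges Q S'.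
  move=> it /finset.setP eSS; apply/finset.setP => e; rewrite !inE.
  case eQ: (e \in Q) => //=; apply: (@crosses_determined _ (Fs i)).
    by move=> f fF; have := eSS f; rewrite !inE fF.
  exact: Q_joined.
(* By [Qdet] the cut edges in [Q] depend on the trace [J] alone, so any cut with this trace
   represents the event. *)
pose dev i J x := if [pick S | trace i S == J] is Some S0 then
  eps * (#|cut_edges Q S0|%:R + t%:R * #|J|%:R) < `|deviation R (cut_edges Q S0) x|
  else false.
have step1 x : (badly_sampled x)%:R <= \sum_(i < t)
   \sum_(J : {set V * V} | (J \subset [set e in Fs i]) && (J != finset.set0)) (dev i J x)%:R :> R.
  case: (boolP (badly_sampled x)) => [/existsP[S badS]|_]; last first.
    by apply: sumr_ge0 => i _; apply: sumr_ge0.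
  pose i := [arg min_(i < Ordinal t_gt0) #|trace i S|].
  have imin (j : 'I_t) : (#|trace i S| <= #|trace j S|)%N.
    by rewrite /i; case: arg_minnP => // ? _; apply.
  rewrite (bigD1 i) //= (bigD1 (trace i S)) /=; last first.
    apply/andP; split; first by apply/fintype.subsetP => e; rewrite inE => /andP[].
    (* With an empty trace the cut has no edge in [Q], so its deviation is zero and cannot exceed
       the tolerance. *)
    apply: contraTneq badS => tr0.
    have -> : cut_edges Q S = finset.set0.
      rewrite (Qdet i S finset.set0) //; last first.
        by rewrite tr0; apply/finset.setP => e; rewrite !inE /crosses !inE andbF.
      by apply/finset.setP => e; rewrite !inE /crosses !inE andbF.
    rewrite /deviation (_ : [set e in finset.set0 | x e] = finset.set0); last first.
      by apply/finset.setP => e; rewrite !inE.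
    rewrite !cards0 mulr0 subrr normr0 -leNgt mulr_ge0 ?addr_ge0 //.
    by case/andP: eps01.
  have -> : dev i (trace i S) x.
    rewrite /dev; case: pickP => [S' /eqP eS'|/(_ S)]; last by rewrite eqxx.
    rewrite (Qdet i S' S) //; apply: le_lt_trans badS.
    rewrite ler_wpM2l ?(andP eps01).1 // lerD2l -natrM ler_nat.
    rewrite -[X in (X * _ <= _)%N](card_ord t) -sum_nat_const.
    by apply: leq_sum => j _; apply: imin.
  rewrite -addrA lerDl; apply: addr_ge0; first exact: sumr_ge0.
  by apply: sumr_ge0 => j _; apply: sumr_ge0.
apply: le_trans; first by apply: ler_sum => x _; exact: step1.
rewrite exchange_big /=.
have y0 : 0 <= y by apply: expR_ge0.
have step2 (i : 'I_t) : \sum_x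
   \sum_(J : {set V * V} | (J \subset [set e in Fs i]) && (J != finset.set0)) (dev i J x)%:R
   <= 4 * m%:R * y * 2 ^+ #|{: V * V}| :> R.
  rewrite exchange_big /=.
  apply: (@le_trans _ _ (\sum_(J : {set V * V} | (J \subset [set e in Fs i])
     && (J != finset.set0)) (2 * y ^+ #|J| * 2 ^+ #|{: V * V}|))).
    apply: ler_sum => J _; rewrite /dev; case: pickP => [S _|_]; last first.
      by rewrite big1 // !mulr_ge0 // exprn_ge0.
    apply: le_trans (chernoff _ _ eps01) _.
    rewrite ler_pM2r ?exprn_gt0 // ler_pM2l // /y -expRM_natr.
    by rewrite ler_expR le_eqVlt; apply/orP; left; apply/eqP; field.
  rewrite -mulr_suml -mulr_sumr ler_pM2r ?exprn_gt0 //.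
  have cF : (#|[set e in Fs i]| <= m)%N.
    by rewrite cardsE; apply: leq_trans (card_size _) (Fs_size (ltn_ord i)).
  (* The sum of [y ^+ #|J|] over nonempty traces is a power of [1 + y] minus one, at most
     [2 * m * y]. *)
  have := sum_subsets [set e in Fs i] y.
  rewrite (bigD1 finset.set0) ?finset.sub0set //= cards0 expr0 => e1.
  have : (1 + y) ^+ #|[set e in Fs i]| <= 1 + 2 * m%:R * y.
    apply: le_trans (exprD1_le y0 y_small).
    by apply: ler_weXn2l => //; rewrite lerDl.
  rewrite -e1; lra.
apply: le_trans; first by apply: ler_sum => i _; exact: step2.
rewrite sumr_const card_ord -mulr_natl.
by rewrite le_eqVlt; apply/orP; left; apply/eqP; field.
Qed.

End UnionBound.

(** * Levels of forests and the resulting estimate of cuts *)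

Section Levels.
Variables (R : realType) (V : finType) (t : nat).
Hypothesis t_gt0 : (0 < t)%N.

(* Slots are grouped into levels of [t] forests; an edge that has passed all
   forests of level [l] goes on iff its coin at level [l] says so. *)
Definition level_filter (X : nat -> pred (V * V)) (q : nat) (e : V * V) : bool :=
  (q.+1 %% t != 0)%N || X (q %/ t)%N e.

Lemma eq_arrivals (kappa kappa' : nat -> pred (V * V)) (s : seq (V * V)) (q : nat) :
  (forall p, (p < q)%N -> kappa p =1 kappa' p) -> arrivals kappa s q = arrivals kappa' s q.
Proof.
elim: q kappa kappa' s => //= q IHq kappa kappa' s eq_k.
rewrite (@eq_filter _ (kappa 0%N) (kappa' 0%N)); last exact: eq_k.
by apply: IHq => p pq; apply: eq_k.
Qed.

Section Fixed.
Variables (X : nat -> pred (V * V)) (s : seq (V * V)).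
Let arr := arrivals (level_filter X) s.
Definition slot (q : nat) : seq (V * V) := grown (arrivals (level_filter X) s q).
Definition level (l : nat) : {set V * V} :=
  [set e in arrivals (level_filter X) s (l * t)].
Definition left_over (l : nat) : {set V * V} :=
  [set e in level l | [forall i : 'I_t, e \notin slot (l * t + i)]].

Lemma mem_arrivalsS q e :
  (e \in arr q.+1) = [&& e \in arr q, e \notin slot q & level_filter X q e].
Proof. by rewrite /arr arrivalsS mem_filter mem_overflow -/(grown _) andbC andbA. Qed.

Lemma mem_arrivals_level l i e : (i < t)%N ->
  (e \in arr (l * t + i)) =
  (e \in level l) && [forall j : 'I_t, (j < i)%N ==> (e \notin slot (l * t + j))].
Proof.
rewrite inE; elim: i => [|i IHi] it.
  by rewrite addn0 -/arr; case: (e \in arr _) => //=; apply/esym/forallP=> j.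
rewrite addnS mem_arrivalsS IHi ?(ltn_trans _ it) // -andbA; congr (_ && _).
rewrite /level_filter -addnS modnMDl modn_small // orTb andbT.
apply/andP/forallP => [[/forallP h1 h2] j|h].
  apply/implyP; rewrite ltnS leq_eqVlt => /orP[/eqP ->//|ji].
  by have /implyP := h1 j; apply.
split; first by apply/forallP => j; apply/implyP => ji; have /implyP := h j; apply; apply: ltnW.
by have /implyP := h (Ordinal (ltnW it)); apply.
Qed.

Lemma joined_left_over l i e : e \in left_over l -> (i < t)%N -> joined (slot (l * t + i)) e.
Proof.
rewrite inE => /andP[el /forallP h] it; apply: joined_grown.
have := mem_arrivals_level l e it; rewrite /arr => ->.
by rewrite el; apply/forallP => j; rewrite h implybT.
Qed.

Lemma levelS l : level l.+1 = [set e in left_over l | X l e].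
Proof.
apply/finset.setP => e; rewrite !inE.
have -> : (l.+1 * t = (l * t + t.-1).+1)%N by rewrite mulSnr -addnS prednK.
have t1 : (t.-1 < t)%N by rewrite prednK.
have := mem_arrivalsS (l * t + t.-1) e; rewrite /arr => ->.
have := mem_arrivals_level l e t1; rewrite /arr => ->.
have -> : level_filter X (l * t + t.-1) e = X l e.
  rewrite /level_filter -addnS prednK // -mulSnr modnMl /=.
  by rewrite divnMDl // divn_small // addn0.
rewrite inE -!andbA; congr (_ && _); rewrite andbA; congr (_ && _).
apply/andP/forallP => [[/forallP h1 h2] j|h].
  have := ltn_ord j; rewrite -{2}(prednK t_gt0) ltnS leq_eqVlt => /orP[/eqP->//|ji].
  by have /implyP := h1 j; apply.
by split; [apply/forallP => j; rewrite h implybT | exact: (h (Ordinal t1))].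
Qed.

(** An edge absorbed by one slot does not reach the next, so the slots of a level and its left-over
    edges partition the level. *)
Lemma card_cut_level l S :
  #|cut_edges (level l) S| = (#|cut_edges (left_over l) S| +
    \sum_(i < t) #|cut_edges [set e in slot (l * t + i)] S|)%N.
Proof.
pose rem i := [set e in level l | [forall j : 'I_t, (j < i)%N ==> (e \notin slot (l * t + j))]].
suff h i : (i <= t)%N -> #|cut_edges (level l) S| = (#|cut_edges (rem i) S| +
    \sum_(j < i) #|cut_edges [set e in slot (l * t + j)] S|)%N.
  rewrite (h t) //; congr (#|cut_edges _ S| + _)%N.
  apply/finset.setP => e; rewrite !inE; congr (_ && _).
  by apply/eq_forallb => j; rewrite ltn_ord.
elim: i => [_|i IHi it].
  rewrite big_ord0 addn0; congr #|cut_edges _ S|.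
  by apply/finset.setP => e; rewrite !inE; case: (e \in arr _) => //=; apply/esym/forallP.
rewrite IHi ?(ltnW it) // big_ord_recr /=.
suff -> : #|cut_edges (rem i) S| =
    (#|cut_edges [set e in slot (l * t + i)] S| + #|cut_edges (rem i.+1) S|)%N.
  by rewrite -addnA [RHS]addnA [RHS]addnC.
rewrite -(cardsID [set e in slot (l * t + i)] (cut_edges (rem i) S)); congr (_ + _)%N.
  apply: eq_card => e; rewrite !inE.
  have [es|] := boolP (e \in slot (l * t + i)); last by rewrite andbF.
  have : e \in arr (l * t + i) by apply: sub_grown es.
  by rewrite mem_arrivals_level // inE => ->; rewrite andbT.
apply: eq_card => e; rewrite !inE; case: (crosses S e); rewrite ?andbF ?andbT //.
case: (e \in arr _); rewrite ?andbF //= andbC.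
apply/andP/forallP => [[/forallP h1 h2] j|h].
  apply/implyP; rewrite ltnS leq_eqVlt => /orP[/eqP->//|ji].
  by have /implyP := h1 j; apply.
split; last by have /implyP := h (Ordinal it); apply.
by apply/forallP => j; apply/implyP => ji; have /implyP := h j; apply; apply: ltnW.
Qed.

End Fixed.

Definition sifted (X : nat -> pred (V * V)) (L : nat) (s : seq (V * V)) :=
  foldl (sift (level_filter X)) (nseq (L * t) [::]) s.

Definition estimate (Fs : seq (seq (V * V))) (S : {set V}) : nat :=
  \sum_(q < size Fs) 2 ^ (q %/ t) * #|cut_edges [set e in nth [::] Fs q] S|.

Definition coins_of (L : nat) (X : {ffun 'I_L -> {ffun V * V -> bool}}) (l : nat) :
  pred (V * V) := fun e => if insub l is Some i then X i e else false.

(** The coins [x] of level [l] are kept apart from [X], of which only the earlier levels matter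
    here, so that they can be redrawn with the forests fixed. *)
Definition level_bad (eps : R) (X : nat -> pred (V * V)) (s : seq (V * V)) (l : nat)
    (x : {ffun V * V -> bool}) : bool :=
  badly_sampled t (fun i => slot X s (l * t + i)) (left_over X s l) eps x.

Lemma estimate_telescope X s L S :
  (estimate (sifted X L s) S = \sum_(l < L) 2 ^ l *
    \sum_(i < t) #|cut_edges [set e in slot X s (l * t + i)] S|)%N.
Proof.
rewrite /estimate /sifted foldl_siftE size_mkseq.
pose f q := (2 ^ (q %/ t) * #|cut_edges [set e in slot X s q] S|)%N.
rewrite (eq_bigr (fun q : 'I__ => f q)); last by move=> q _; rewrite nth_mkseq.
elim: L => [|L IHL]; first by rewrite !big_ord0.
rewrite big_ord_recr /= -IHL mulSnr big_split_ord /=; congr (_ + _)%N.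
rewrite big_distrr /=; apply: eq_bigr => i _.
by rewrite /f divnMDl // divn_small // addn0.
Qed.

(** Each good level causes a relative error of at most [eps]; over [L] levels with
    [eps = (2 * L)^-1] this costs at most a factor [2]. *)
Lemma estimateP (eps : R) X s L :
  (0 < L)%N -> eps = (2 * L%:R)^-1 -> (2 * #|[set e in s]| < 2 ^ L)%N ->
  (forall l, (l < L)%N -> ~~ level_bad eps X s l [ffun e => X l e]) ->
  forall S, (#|cut_edges [set e in s] S| <= 2 * estimate (sifted X L s) S)%N /\
            (estimate (sifted X L s) S <= 2 * #|cut_edges [set e in s] S|)%N.
Proof.
move=> L0 eps_def sL good S.
have Lr : 1 <= L%:R :> R by rewrite ler1n.
have eL : eps * L%:R = 2^-1.
  by rewrite eps_def invfM -mulrA mulVf ?mulr1 // gt_eqF // (lt_le_trans ltr01).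
have eps0 : 0 <= eps by rewrite eps_def invr_ge0; lra.
have eps2 : eps <= 2^-1 by nra.
pose b l : nat := \sum_(i < t) #|cut_edges [set e in slot X s (l * t + i)] S|.
pose g l : nat := #|cut_edges (level X s l) S|.
(* Hybrid quantities: the posted cut edges below level [l], with their multiplicities, plus [2 ^ l]
   times the cut edges reaching level [l]. They lead from the true cut to the estimate. *)
pose T l : R := (\sum_(i < l) 2 ^ i * b i + 2 ^ l * g l)%:R.
have T0 l : 0 <= T l by apply: ler0n.
have gT l : (2 ^ l * g l)%:R <= T l by rewrite ler_nat leq_addl.
have step l : (l < L)%N -> `|T l.+1 - T l| <= eps * T l.
  move=> lL; have := good l lL; rewrite negb_exists => /forallP/(_ S); rewrite -leNgt.
  rewrite -natrD -card_cut_level -/(g l) /deviation => h.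
  have -> : T l.+1 - T l = 2 ^+ l * (2 * (g l.+1)%:R - #|cut_edges (left_over X s l) S|%:R).
    rewrite /T big_ord_recr /= /g (card_cut_level X s l S) -/(b l) !natrD !natrM !natrX exprS.
    by ring.
  rewrite normrM ger0_norm ?exprn_ge0 //.
  apply: le_trans (_ : 2 ^+ l * (eps * (g l)%:R) <= _); last first.
    by rewrite mulrCA; apply: ler_wpM2l => //; rewrite -natrX -natrM.
  apply: ler_wpM2l; first exact: exprn_ge0.
  move: h; congr (`|2 * _ - _| <= _).
  rewrite /g levelS; congr (_%:R); apply: eq_card => e.
  by rewrite !inE ffunE -!andbA; do !bool_congr.
have lower l : (l <= L)%N -> (1 - eps) ^+ l * T 0 <= T l.
  elim: l => [|l IHl] lL; first by rewrite expr0 mul1r.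
  have := step l lL; rewrite ler_norml => /andP[h _].
  have {}IHl := IHl (ltnW lL).
  apply: le_trans (_ : (1 - eps) * T l <= _); last by lra.
  by rewrite exprS -mulrA; apply: ler_wpM2l => //; lra.
have upper l : (l <= L)%N -> (1 - eps) ^+ l * T l <= T 0.
  elim: l => [|l IHl] lL; first by rewrite expr0 mul1r.
  have := step l lL; rewrite ler_norml => /andP[_ h].
  apply: le_trans (IHl (ltnW lL)); rewrite exprSr -mulrA; apply: ler_wpM2l.
    by apply: exprn_ge0; lra.
  have Tl := T0 l; have h2 : T l.+1 <= (1 + eps) * T l by lra.
  apply: le_trans (_ : (1 - eps) * ((1 + eps) * T l) <= _); first by apply: ler_wpM2l => //; lra.
  nra.
have bernoulli l : 1 - l%:R * eps <= (1 - eps) ^+ l.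
  elim: l => [|l IHl]; first by rewrite mul0r subr0 expr0.
  rewrite exprS; apply: le_trans (_ : (1 - eps) * (1 - l%:R * eps) <= _).
    rewrite -natr1; have : 0 <= l%:R * eps by apply: mulr_ge0. by nra.
  by apply: ler_wpM2l => //; lra.
have half : 2^-1 <= (1 - eps) ^+ L.
  by have := bernoulli L; rewrite mulrC eL; lra.
have TL1 : T 0%N <= 2 * T L by have := lower L (leqnn L); have := T0 0%N; nra.
have TL2 : T L <= 2 * T 0%N by have := upper L (leqnn L); have := T0 L; nra.
have T0E : T 0%N = #|cut_edges [set e in s] S|%:R.
  by rewrite /T big_ord0 add0n mul1n /g /level mul0n.
(* [2 ^ L * g L] is at most [T L], hence at most twice the number of edges, which is below
   [2 ^ L]. *)
have gL0 : g L = 0%N.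
  apply/eqP; rewrite -leqn0 -ltnS -(ltn_pmul2l (expn_gt0 2 L)) muln1.
  apply: leq_ltn_trans sL; rewrite -(ler_nat R).
  apply: le_trans (gT L) _; apply: le_trans TL2 _; rewrite T0E -natrM ler_nat leq_mul2l /=.
  by apply: subset_leq_card; apply/fintype.subsetP => e; rewrite inE => /andP[].
have TLE : T L = (estimate (sifted X L s) S)%:R.
  by rewrite /T gL0 muln0 addn0 estimate_telescope.
by split; rewrite -(ler_nat R) natrM -T0E -TLE.
Qed.

Section Resample.
Variables (I : finType) (C : finType).

Definition update (X : {ffun I -> C}) (i : I) (x : C) : {ffun I -> C} :=
  [ffun j => if j == i then x else X j].

(** Exchanging the coordinate [i] of [X] with the fresh value [x] is an involution on pairs. *)
Lemma resample (f : {ffun I -> C} -> R) (i : I) :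
  \sum_X \sum_x f (update X i x) = #|C|%:R * \sum_X f X.
Proof.
rewrite pair_big /=.
pose h (p : {ffun I -> C} * C) := (update p.1 i p.2, p.1 i).
have hK : involutive h.
  move=> [X x]; rewrite /h /=; congr (_, _); last by rewrite ffunE eqxx.
  by apply/ffunP => j; rewrite !ffunE; case: eqP => [->|].
rewrite (reindex_inj (inv_inj hK)) /=.
rewrite (eq_bigr (fun p : {ffun I -> C} * C => f p.1)); last first.
  move=> [X x] _ /=; congr (f _).
  by apply/ffunP => j; rewrite !ffunE; case: eqP => [->|].
rewrite -(pair_big xpredT xpredT (fun X (_ : C) => f X)) /=.
by rewrite mulr_sumr; apply: eq_bigr => X _; rewrite sumr_const mulr_natl.
Qed.

End Resample.

Lemma level_filter_eq X X' l i : (i < t)%N -> (forall l', (l' < l)%N -> X l' =1 X' l') ->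
  forall p, (p < l * t + i)%N -> level_filter X p =1 level_filter X' p.
Proof.
move=> it eqX p pl e; rewrite /level_filter; case: eqP => //= p0; apply: eqX.
have /dvdnP[a ap] : (t %| p.+1)%N by apply/eqP.
have -> : (p %/ t = a.-1)%N.
  have a0 : (0 < a)%N by case: a ap.
  have -> : p = (a.-1 * t + t.-1)%N.
    apply: succn_inj; rewrite ap -addnS prednK // -[in LHS](prednK a0) mulSn addnC //.
  by rewrite divnMDl // divn_small ?addn0 // prednK.
have : (a * t < l.+1 * t)%N by rewrite -ap mulSnr (leq_ltn_trans pl) // ltn_add2l.
rewrite ltn_pmul2r // ltnS; case: a ap => // a _.
Qed.

(** Redrawing only the coins of level [l] leaves its forests and its left-over edges unchanged, so
    [badly_sampled_le] applies for every choice of the other coins. *)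
Lemma level_bad_sum (eps : R) (L : nat) (s : seq (V * V)) (l : 'I_L) :
  0 <= eps <= 1 -> let y := expR (- (eps ^+ 2 * t%:R / 2)) in
  #|V|%:R * y <= 2^-1 ->
  \sum_(X : {ffun 'I_L -> {ffun V * V -> bool}}) (level_bad eps (coins_of X) s l (X l))%:R
  <= 4 * t%:R * #|V|%:R * y * #|{ffun 'I_L -> {ffun V * V -> bool}}|%:R.
Proof.
move=> eps01 y y_small; set C := ({ffun V * V -> bool}).
have C0 : 0 < #|{: C}|%:R :> R by rewrite ltr0n card_ffun expn_gt0 card_bool.
rewrite -(ler_pM2l C0) -(resample _ l).
rewrite [leRHS](_ : _ = \sum_(X : {ffun 'I_L -> C}) 4 * t%:R * #|V|%:R * y * #|{: C}|%:R); last first.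
  by rewrite sumr_const -mulr_natr; ring.
apply: ler_sum => X _.
have -> : #|{: C}|%:R = 2 ^+ #|{: V * V}| :> R by rewrite card_ffun card_bool natrX.
apply: le_trans (badly_sampled_le (Q := left_over (coins_of X) s l)
  (Fs := fun i => slot (coins_of X) s (l * t + i)) t_gt0 eps01 _ _ y_small).
- rewrite le_eqVlt; apply/orP; left; apply/eqP; apply: eq_bigr => x _.
  have arrE i : (i < t)%N -> arrivals (level_filter (coins_of (update X l x))) s (l * t + i)
      = arrivals (level_filter (coins_of X)) s (l * t + i).
    move=> it; apply: eq_arrivals; apply: level_filter_eq => // l' ll' e.
    rewrite /coins_of; case: insubP => // u _ ul; rewrite ffunE.
    by case: eqP => // ul2; move: ll'; rewrite -ul ul2 ltnn.
  have slotE i : (i < t)%N -> slot (coins_of (update X l x)) s (l * t + i) = slot (coins_of X) s (l * t + i).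
    by move=> it; rewrite /slot arrE.
  rewrite ffunE eqxx /level_bad /badly_sampled; congr (nat_of_bool _)%:R.
  have -> : left_over (coins_of (update X l x)) s l = left_over (coins_of X) s l.
    apply/finset.setP => e; rewrite !inE -[(l * t)%N]addn0 arrE //; congr (_ && _).
    by apply/eq_forallb => i; rewrite addn0 slotE.
  apply/eq_existsb => S; congr (_ * (_ + _%:R) < _).
  by apply: eq_bigr => i _; rewrite slotE.
- by move=> i _; apply: forest_size; apply: forest_grown.
- by move=> e i eR it; apply: joined_left_over.
Qed.

End Levels.

(** * Public coins *)

Section Newman.
Local Open Scope nat_scope.

(** Bernoulli's inequality in natural numbers: induction bounds [(a + b) ^ j * (a - j * b)] by
    [a ^ j.+1], and [a - q * b] is at least half of [a]. *)
Lemma expnD_le_double (a b q : nat) : 2 * q * b <= a -> (a + b) ^ q <= 2 * a ^ q.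
Proof.
move=> qb; have [a0|a0] := posnP a.
  move: qb; rewrite a0 leqn0 !muln_eq0 /= => /orP[/eqP->//|/eqP->].
  by rewrite addn0; case: (q) => // q'; rewrite exp0n.
have step j : j <= q -> (a + b) ^ j * (a - j * b) <= a ^ j.+1.
  elim: j => [|j IHj] jq; first by rewrite mul0n subn0 mul1n expn1.
  have {}IHj := IHj (ltnW jq).
  apply: leq_trans (_ : a * ((a + b) ^ j * (a - j * b)) <= _); last first.
    by rewrite [X in _ <= X]expnS leq_mul2l IHj orbT.
  rewrite expnSr -mulnA [X in _ <= X]mulnCA leq_mul2l; apply/orP; right.
  have jb : j.+1 * b <= a.
    by apply: leq_trans qb; rewrite leq_mul2r (leq_trans jq) ?orbT // leq_pmull.
  by nia.
have := step q (leqnn q); rewrite expnSr => h.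
rewrite -(leq_pmul2r a0); apply: leq_trans (_ : 2 * ((a + b) ^ q * (a - q * b)) <= _).
  rewrite mulnCA leq_mul2l; apply/orP; right; lia.
by rewrite -mulnA leq_mul2l h.
Qed.

(* Newman's argument: the expectation over a random list [Z] of
   2^(number of bad seeds) is small enough to sum over all inputs. *)
Lemma newman (C I : finType) (bad : C -> I -> bool) (q N : nat) :
  0 < #|C| -> 0 < N -> #|I| < 2 ^ N -> (forall i, 2 * q * \sum_c bad c i <= #|C|) ->
  exists Z : {ffun 'I_(q * N) -> C}, forall i, \sum_m bad (Z m) i < 2 * N.
Proof.
move=> C0 N0 IN bad_le; suff /existsP[Z /forallP h] : [exists Z : {ffun 'I_(q * N) -> C},
    [forall i, \sum_m bad (Z m) i < 2 * N]] by exists Z.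
apply/contraT; rewrite negb_exists => /forallP allbad.
(* If every list failed on some input, each would contribute at least [2 ^ (2 * N)]; independence of
   the entries bounds the average contribution of one input by [2 ^ N]. *)
have lower : #|C| ^ (q * N) * 2 ^ (2 * N) <=
    \sum_(Z : {ffun 'I_(q * N) -> C}) \sum_i 2 ^ (\sum_m bad (Z m) i).
  rewrite -[X in _ ^ X * _]card_ord -card_ffun -sum_nat_const; apply: leq_sum => Z _.
  have := allbad Z; rewrite negb_forall => /existsP[i]; rewrite -leqNgt => h.
  rewrite (bigD1 i) //=; apply: leq_trans (leq_addr _ _).
  by rewrite leq_exp2l.
have upper : \sum_(Z : {ffun 'I_(q * N) -> C}) \sum_i 2 ^ (\sum_m bad (Z m) i) <=
    #|I| * (#|C| ^ (q * N) * 2 ^ N).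
  rewrite exchange_big /= -sum_nat_const; apply: leq_sum => i _.
  under eq_bigr do rewrite expn_sum.
  rewrite -(bigA_distr_bigA (fun _ c => 2 ^ bad c i)) /= prod_nat_const card_ord.
  have -> : \sum_c 2 ^ bad c i = #|C| + \sum_c bad c i.
    by rewrite -sum1_card -big_split /=; apply: eq_bigr => c _; case: (bad c i).
  rewrite !expnM -expnMn leq_exp2r // mulnC.
  exact: expnD_le_double.
have := leq_trans lower upper.
rewrite [X in _ <= X]mulnCA leq_pmul2l ?expn_gt0 ?C0 // mul2n -addnn expnD.
by rewrite leq_pmul2r ?expn_gt0 // leqNgt IN.
Qed.

End Newman.


(** * A short list of seeds suitable for all inputs *)

Section Seeds.
Variables (R : realType) (V : finType).

Definition estimate_good (t : nat) (Fs : seq (seq (V * V))) (Q : {set V * V}) : bool :=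
  [forall S : {set V}, (#|cut_edges Q S| <= 2 * estimate t Fs S)%N &&
                       (estimate t Fs S <= 2 * #|cut_edges Q S|)%N].

Lemma bad_coins_sum (L t : nat) (s : seq (V * V)) (y : R) :
  (0 < t)%N -> (0 < L)%N -> (2 * #|{: V * V}| < 2 ^ L)%N ->
  expR (- ((2 * L%:R)^-1 ^+ 2 * t%:R / 2)) <= y -> #|V|%:R * y <= 2^-1 ->
  \sum_(X : {ffun 'I_L -> {ffun V * V -> bool}})
    (~~ estimate_good t (sifted t (coins_of X) L s) [set e in s])%:R
  <= L%:R * (4 * t%:R * #|V|%:R * y) * #|{ffun 'I_L -> {ffun V * V -> bool}}|%:R.
Proof.
move=> t0 L0 EL ey Vy; set eps : R := (2 * L%:R)^-1.
have L1 : 1 <= L%:R :> R by rewrite ler1n.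
have eps01 : 0 <= eps <= 1.
  apply/andP; split; first by rewrite /eps invr_ge0; lra.
  by rewrite /eps invf_le1; lra.
apply: (@le_trans _ _ (\sum_(X : {ffun 'I_L -> {ffun V * V -> bool}})
   \sum_(l < L) (level_bad t eps (coins_of X) s l (X l))%:R)).
  apply: ler_sum => X _.
  case: (boolP [forall l : 'I_L, ~~ level_bad t eps (coins_of X) s l (X l)]) => [/forallP h|].
    rewrite (_ : estimate_good _ _ _); first by apply: sumr_ge0.
    apply/forallP => S; apply/andP; apply: (@estimateP R V t t0 eps) => //.
      apply: leq_ltn_trans EL; rewrite leq_mul2l; exact: max_card.
    move=> l lL; have := h (Ordinal lL); congr (~~ level_bad _ _ _ _ _ _).
    apply/ffunP => e; rewrite ffunE /coins_of insubT /=; congr (X _ e); exact: val_inj.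
  rewrite negb_forall => /existsP[l]; rewrite negbK => bl.
  rewrite (bigD1 l) //= bl; apply: (@le_trans _ _ 1); first by rewrite lern1 leq_b1.
  by rewrite lerDl; apply: sumr_ge0.
rewrite exchange_big /= -mulrA mulr_natl -[X in _ *+ X]card_ord -sumr_const.
apply: ler_sum => l _.
apply: le_trans (level_bad_sum t0 s l eps01 _) _.
  by apply: le_trans Vy; apply: ler_wpM2l.
by rewrite ler_wpM2r // ler_wpM2l // !mulr_ge0.
Qed.

(** The value of [t] makes the Chernoff exponent at [eps = (2 * L)^-1] exactly [tau]; the bound on
    [2 ^ tau] then leaves a fraction of at most [1 / (2 * q)] bad seeds per input, as [newman]
    requires. *)
Lemma sparsifier_seeds (I : finType) (src : I -> seq (V * V)) (L tau q N : nat) :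
  (0 < L)%N -> (0 < tau)%N -> (0 < N)%N -> (0 < q)%N ->
  (2 * #|{: V * V}| < 2 ^ L)%N -> (64 * L ^ 3 * tau * #|V| * q <= 2 ^ tau)%N ->
  (#|I| < 2 ^ N)%N ->
  let t := (8 * L ^ 2 * tau)%N in
  exists Z : 'I_(q * N) -> nat -> pred (V * V), forall i,
    (\sum_m ~~ estimate_good t (sifted t (Z m) L (src i)) [set e in src i] < 2 * N)%N.
Proof.
move=> L0 tau0 N0 q0 EL tau_large IN t.
have t0 : (0 < t)%N by rewrite !muln_gt0 L0 tau0.
pose bad (X : {ffun 'I_L -> {ffun V * V -> bool}}) i :=
  ~~ estimate_good t (sifted t (coins_of X) L (src i)) [set e in src i].
have [] := @newman {ffun 'I_L -> {ffun V * V -> bool}} I bad q N _ N0 IN.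
- by rewrite card_ffun expn_gt0 card_ffun expn_gt0 card_bool.
- move=> i; pose y : R := (2 ^+ tau)^-1.
  have two0 : 0 < 2 ^+ tau :> R by rewrite exprn_gt0.
  have L1 : 0 < L%:R :> R by rewrite ltr0n.
  have V_le : #|V|%:R * y <= 2^-1 :> R.
    rewrite /y ler_pdivrMr // mulrC ler_pdivlMr // -natrX -natrM ler_nat.
    apply: leq_trans tau_large; rewrite mulnC -mulnA leq_mul //.
      by rewrite -mulnA -[X in (X <= _)%N]muln1 leq_mul // muln_gt0 expn_gt0 L0.
    by rewrite leq_pmulr.
  have ey : expR (- ((2 * L%:R)^-1 ^+ 2 * t%:R / 2)) <= y :> R.
    have -> : (2 * L%:R)^-1 ^+ 2 * t%:R / 2 = tau%:R :> R.
      rewrite /t !natrM ?natrX; field; exact: lt0r_neq0.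
    rewrite expRN /y lef_pV2 ?posrE ?expR_gt0 // -[tau%:R]mul1r expRM_natr.
    apply: lerXn2r; rewrite ?nnegrE ?expR_ge0 //.
    by apply: le_trans (expR_ge1Dx 1); lra.
  have := bad_coins_sum (src i) t0 L0 EL ey V_le.
  rewrite -natr_sum -/bad => h.
  rewrite -(ler_nat R) natrM; apply: le_trans (_ : (2 * q)%:R *
    (L%:R * (4 * t%:R * #|V|%:R * y) * #|{ffun 'I_L -> {ffun V * V -> bool}}|%:R) <= _).
    by rewrite ler_wpM2l.
  rewrite mulrA -[leRHS]mul1r ler_wpM2r //.
  have -> : (2 * q)%:R * (L%:R * (4 * t%:R * #|V|%:R * y)) =
            (64 * L ^ 3 * tau * #|V| * q)%:R * y :> R.
    by rewrite /t !natrM ?natrX; ring.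
  by rewrite /y ler_pdivrMr // mul1r -natrX ler_nat.
- by move=> Z hZ; exists (fun m => coins_of (Z m)).
Qed.

End Seeds.

(** * Bit encodings of protocols *)

Section Codec.
Local Open Scope nat_scope.
Variables (T : finType) (N : nat).
Hypothesis T_le : #|T| <= 2 ^ N.

Definition encode (x : T) : seq bool :=
  nth (nseq N false) (map val (enum {: N.-tuple bool})) (enum_rank x).

Definition decode (x0 : T) (h : seq bool) : T :=
  if [pick x | encode x == h] is Some x then x else x0.

Lemma size_encode x : size (encode x) = N.
Proof.
rewrite /encode; set r := nat_of_ord _.
have [rl|rl] := ltnP r (size (enum {: N.-tuple bool})).
  have [t0 _] : exists t : N.-tuple bool, true by exists [tuple of nseq N false].
  by rewrite (nth_map t0) // size_tuple.
rewrite nth_default; first exact: size_nseq.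
by rewrite size_map.
Qed.

Lemma encode_inj : injective encode.
Proof.
move=> x y; rewrite /encode => /eqP; rewrite nth_uniq.
- by move=> /eqP/val_inj/enum_rank_inj.
- by rewrite size_map -cardE card_tuple card_bool (leq_trans (ltn_ord _)).
- by rewrite size_map -cardE card_tuple card_bool (leq_trans (ltn_ord _)).
- by rewrite map_inj_uniq ?enum_uniq //; apply: val_inj.
Qed.

Lemma encodeK x0 : cancel encode (decode x0).
Proof.
move=> x; rewrite /decode; case: pickP => [y /eqP/encode_inj //|/(_ x)].
by rewrite eqxx.
Qed.

End Codec.

(** * Passing a state from site to site through the coordinator *)

Section Relay.
Local Open Scope nat_scope.
Variables (R : realType) (n s : nat) (Out : Type) (C : private_coins R s).
Variables (T : finType) (N : nat) (x0 : T).
Hypothesis T_le : #|T| <= 2 ^ N.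
Hypothesis N_gt0 : 0 < N.
Variables (init : coin C -> T) (upd : 'I_s -> 'M[R]_n -> T -> T) (out : T -> Out).

Let enc := @encode T N.
Let dec := decode N x0.
(** The state before site [i] is served, read off from the reply on channel [i - 1]; index [0] is
    the initial state. *)
Let received (c : coin C) (h : {ffun 'I_s -> seq bool}) (i : nat) : T :=
  if i is i'.+1 then
    if insub i' is Some j then dec (drop N (h j)) else x0
  else init c.
Let clock (h : {ffun 'I_s -> seq bool}) := \sum_j size (h j).

(* The coordinator forwards to each site in turn the [N]-bit state received from
   the previous one, and the site replies with the updated state. *)
Definition relay : mp_protocol R n s Out := {|
  mp_coins := C;
  mp_steps := 2 * N * s;
  mp_select := fun _ h => insub (clock h %/ (2 * N));
  mp_site_speaks := fun _ h => N <= size h;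
  mp_site_bit := fun i x _ h => nth false (enc (upd i x (dec (take N h)))) (size h - N);
  mp_coord_bit := fun c h =>
    nth false (enc (received c h (clock h %/ (2 * N)))) (clock h %% (2 * N));
  mp_decide := fun c h => out (received c h s)
|}.

Section Run.
Variables (x : 'I_s -> 'M[R]_n) (om : outcome C s).

Let st (i : nat) : T :=
  foldl (fun tau j => upd j (x j) tau) (init (om None)) (take i (enum 'I_s)).
Let full (i : nat) := enc (st i) ++ enc (st i.+1).
(** The histories after [m] bits in all: channel [j] is active from bit [2 * N * j] on, and
    truncated subtraction leaves it empty before. *)
Let hist (m : nat) : {ffun 'I_s -> seq bool} := [ffun j : 'I_s => take (m - 2 * N * j) (full j)].

Let st_S (j : 'I_s) : st j.+1 = upd j (x j) (st j).
Proof.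
rewrite /st (take_nth j) ?size_enum_ord // -cats1 foldl_cat /=.
by rewrite nth_ord_enum.
Qed.

Let size_full i : size (full i) = 2 * N.
Proof. by rewrite size_cat !size_encode addnn mul2n. Qed.

Let clock_hist m : m <= 2 * N * s -> clock (hist m) = m.
Proof.
move=> mle; rewrite /clock (eq_bigr (fun j : 'I_s => minn (m - 2 * N * j) (2 * N))); last first.
  by move=> j _; rewrite ffunE size_take_min size_full.
suff -> k : \sum_(j < k) minn (m - 2 * N * j) (2 * N) = minn m (2 * N * k) by apply/minn_idPl.
elim: k => [|k IHk]; first by rewrite big_ord0 muln0 minn0.
by rewrite big_ord_recr /= IHk mulnSr; lia.
Qed.

Let drop_full (m : nat) (j : 'I_s) : 2 * N * j.+1 <= m -> drop N (hist m j) = enc (st j.+1).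
Proof.
move=> h; rewrite ffunE take_oversize; last by rewrite size_full; lia.
by rewrite /full drop_size_cat // size_encode.
Qed.

Let received_hist m i : i <= s -> 2 * N * i <= m -> received (om None) (hist m) i = st i.
Proof.
case: i => [|i] is_ im; first by rewrite /= /st take0.
by rewrite /received insubT /= drop_full //= /dec encodeK.
Qed.

Let hist_step m : m < 2 * N * s -> mp_step (pi := relay) x om (hist m) = hist m.+1.
Proof.
move=> ms; rewrite /mp_step /= clock_hist ?(ltnW ms) //.
have N2 : 0 < 2 * N by lia.
have is_ : m %/ (2 * N) < s by rewrite ltn_divLR // mulnC.
have mE := divn_eq m (2 * N); have rl : m %% (2 * N) < 2 * N by rewrite ltn_pmod.
set i := m %/ (2 * N) in is_ mE *; set r := m %% (2 * N) in mE rl *.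
rewrite insubT /=; set i' : 'I_s := Sub i is_.
have hi : hist m i' = take r (full i).
  rewrite ffunE /=; congr (take _ _); rewrite mE; lia.
apply/ffunP => j; rewrite ffunE; case: eqVneq => [->|ji].
  rewrite hi ffunE /= -/(full i) (_ : m.+1 - 2 * N * i = r.+1); last by rewrite mE; lia.
  rewrite (take_nth false) ?size_full //; congr (rcons _ _).
  rewrite size_take size_full rl /full nth_cat size_encode.
  have [Nr|rN] := leqP N r.
    congr (nth _ (enc _) _).
    rewrite (st_S i') /=; congr (upd _ _ _).
    rewrite take_takel // take_size_cat ?size_encode //.
    by rewrite /dec encodeK.
  congr (nth _ (enc _) _); apply: received_hist; first exact: ltnW.
  by rewrite mE; lia.
rewrite !ffunE; have [lt|lt] := ltnP j i.
  by rewrite !take_oversize // size_full mE; nia.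
have {}lt : i < j by rewrite ltn_neqAle lt andbT eq_sym; apply: contraNneq ji => h; apply/eqP/val_inj.
by rewrite (_ : m.+1 - _ = m - 2 * N * j) // mE; nia.
Qed.

Lemma relay_run : mp_run relay x om = hist (2 * N * s).
Proof.
rewrite /mp_run /=.
suff h m : m <= 2 * N * s -> iter m (mp_step (pi := relay) x om) [ffun=> [::]] = hist m by apply: h.
elim: m => [_|m IHm ms] /=; last by rewrite IHm ?(ltnW ms) // hist_step.
by apply/ffunP => j; rewrite !ffunE sub0n take0.
Qed.

Lemma relay_output : mp_output relay x om =
  out (foldl (fun tau j => upd j (x j) tau) (init (om None)) (enum 'I_s)).
Proof.
rewrite /mp_output relay_run /= received_hist // /st take_oversize //.
by rewrite size_enum_ord.
Qed.

Lemma relay_cost : mp_cost relay x om = 2 * N * s.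
Proof. by rewrite /mp_cost relay_run; apply: clock_hist. Qed.

End Run.
End Relay.

(** * Writing tokens of fixed length on the blackboard *)

Section Tokens.
Local Open Scope nat_scope.
Variables (R : realType) (n s : nat) (Out : Type) (C : private_coins R s).
Variables (T : finType) (N : nat) (x0 : T).
Hypothesis T_le : #|T| <= 2 ^ N.
Hypothesis N_gt0 : 0 < N.
Variables (turn : seq T -> option (option 'I_s)) (site_tok : 'I_s -> 'M[R]_n -> seq T -> T).
Variables (coord_tok : coin C -> seq T -> T) (out : seq T -> Out) (steps : nat).

Let enc := @encode T N.
Let dec := decode N x0.

(** Only complete blocks of [N] bits are decoded, so the decoded sequence does not change while a
    token is being written. *)
Definition read_tokens (h : seq bool) : seq T :=
  map dec (reshape (nseq (size h %/ N) N) h).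

Definition token_board : bb_protocol R n s Out := {|
  bb_coins := C;
  bb_steps := N * steps;
  bb_turn := fun h => turn (read_tokens h);
  bb_site_bit := fun i x _ h => nth false (enc (site_tok i x (read_tokens h))) (size h %% N);
  bb_coord_bit := fun c h => nth false (enc (coord_tok c (read_tokens h))) (size h %% N);
  bb_decide := fun _ h => out (read_tokens h)
|}.

Variables (x : 'I_s -> 'M[R]_n) (om : outcome C s).

Definition token_step (ts : seq T) : seq T :=
  match turn ts with
  | None => ts
  | Some None => rcons ts (coord_tok (om None) ts)
  | Some (Some i) => rcons ts (site_tok i (x i) ts)
  end.

Let encs (ts : seq T) := flatten (map enc ts).

Let size_encs ts : size (encs ts) = N * size ts.
Proof.
elim: ts => [|t ts IHts] /=; first by rewrite muln0.
by rewrite /encs /= size_cat size_encode IHts mulnS.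
Qed.

Let read_encs ts p : size p < N -> read_tokens (encs ts ++ p) = ts.
Proof.
move=> pN; rewrite /read_tokens size_cat size_encs mulnC divnMDl // divn_small // addn0.
elim: ts => //= t ts IHts; rewrite /encs /= -catA take_size_cat ?size_encode //.
by rewrite drop_size_cat ?size_encode // {1}/dec encodeK // IHts.
Qed.

(** Expressing the partial token as a suffix of the next board also covers a halted protocol, where
    this suffix is empty. *)
Let bb_step_encs ts r : r < N ->
  bb_step (pi := token_board) x om (encs ts ++ take r (drop (size (encs ts)) (encs (token_step ts)))) =
  encs ts ++ take r.+1 (drop (size (encs ts)) (encs (token_step ts))).
Proof.
move=> rN; rewrite /bb_step /= read_encs; last by rewrite size_take; case: ifP => //; lia.
have extend t b : (b = nth false (enc t) ((N * size ts + r) %% N)) ->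
    rcons (encs ts ++ take r (enc t)) b = encs ts ++ take r.+1 (enc t).
  move=> ->; rewrite (take_nth false) ?size_encode // rcons_cat; congr (_ ++ rcons _ _).
  by rewrite mulnC modnMDl modn_small.
have dropE t : drop (size (encs ts)) (encs (rcons ts t)) = enc t.
  by rewrite /encs map_rcons -cats1 flatten_cat /= cats0 drop_size_cat.
have sz t : size (encs ts ++ take r (enc t)) = N * size ts + r.
  by rewrite size_cat size_encs size_take size_encode rN.
rewrite /token_step; case: (turn ts) => [[i|]|].
- by rewrite dropE; apply: extend; rewrite sz.
- by rewrite dropE; apply: extend; rewrite sz.
- by rewrite drop_size.
Qed.

Let prefix_step ts : encs (token_step ts) = encs ts ++ take N (drop (size (encs ts)) (encs (token_step ts))).
Proof.
have encs_rcons t : encs (rcons ts t) = encs ts ++ enc t.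
  by rewrite /encs map_rcons -cats1 flatten_cat /= cats0.
rewrite /token_step; case: (turn ts) => [[i|]|]; last by rewrite drop_size cats0.
  by rewrite encs_rcons drop_size_cat // take_oversize // size_encode.
by rewrite encs_rcons drop_size_cat // take_oversize // size_encode.
Qed.

Lemma token_board_run : bb_run token_board x om = encs (iter steps token_step [::]).
Proof.
rewrite /bb_run /=; elim: steps => [|m IHm]; first by rewrite muln0.
rewrite mulnS iterD IHm iterS prefix_step; set ts := iter m _ _.
suff h r : r <= N -> iter r (bb_step (pi := token_board) x om) (encs ts) =
    encs ts ++ take r (drop (size (encs ts)) (encs (token_step ts))) by apply: h.
elim: r => [_|r IHr rN]; first by rewrite take0 cats0.
by rewrite iterS IHr ?(ltnW rN) // bb_step_encs.
Qed.

Lemma token_board_output : bb_output token_board x om = out (iter steps token_step [::]).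
Proof.
by rewrite /bb_output token_board_run /= -[encs _]cats0 read_encs.
Qed.

Lemma token_board_cost : bb_cost token_board x om = N * size (iter steps token_step [::]).
Proof. by rewrite /bb_cost token_board_run size_encs. Qed.

End Tokens.

(** * Closeness of partitions of small conductance *)

Section SpectralFrame.
Import sesquilinear spectral complex.
Local Open Scope sesquilinear_scope.
Variable R : realType.

Let Remx m n (X : 'M[R[i]]_(m, n)) : 'M[R]_(m, n) := map_mx (@complex.Re R) X.
Let Immx m n (X : 'M[R[i]]_(m, n)) : 'M[R]_(m, n) := map_mx (@complex.Im R) X.

Lemma Remx_mul m n p (X : 'M[R[i]]_(m, n)) (Y : 'M[R[i]]_(n, p)) :
  Remx (X *m Y) = Remx X *m Remx Y - Immx X *m Immx Y.
Proof.
apply/matrixP => i j; rewrite !mxE raddf_sum -sumrB; apply: eq_bigr => l _.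
by rewrite !mxE; case: (X i l) => a b; case: (Y l j) => c d.
Qed.

Lemma Immx_mul m n p (X : 'M[R[i]]_(m, n)) (Y : 'M[R[i]]_(n, p)) :
  Immx (X *m Y) = Remx X *m Immx Y + Immx X *m Remx Y.
Proof.
apply/matrixP => i j; rewrite !mxE raddf_sum -big_split; apply: eq_bigr => l _.
by rewrite !mxE; case: (X i l) => a b; case: (Y l j) => c d.
Qed.

(** [a] and [b] are the real and imaginary parts of a complex unitary diagonalizing [A]. Their rows
    form a real Parseval frame, which serves in place of a real orthonormal eigenbasis; row [i] of
    either belongs to the eigenvalue [d 0 i]. *)
Lemma symmetric_frame n (A : 'M[R]_n) (l : seq R) : A^T = A -> is_spectrum A l ->
  exists (a b : 'M[R]_n) (d : 'rV[R]_n),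
  [/\ a^T *m a + b^T *m b = 1%:M, a *m a^T + b *m b^T = 1%:M,
      a^T *m diag_mx d *m a + b^T *m diag_mx d *m b = A,
      a *m A *m a^T + b *m A *m b^T = diag_mx d &
      perm_eq l [seq d 0 i | i <- enum 'I_n]].
Proof.
move=> At [_ charA]; pose B : 'M[R[i]]_n := map_mx (real_complex R) A.
have Bherm : B \is hermsymmx.
  apply: realsym_hermsym.
    by apply/is_hermitianmxP; rewrite expr0 scale1r map_mx_id // map_trmx At.
  by apply/mxOverP => i j; rewrite mxE; apply/complex_realP; exists (A i j).
have spR := hermitian_spectral_diag_real Bherm.
have /orthomx_spectralP Beq := hermitian_normalmx Bherm.
set P := spectralmx B in Beq; have Punit := spectral_unitarymx B.
rewrite -/P in Punit.
have PP : P *m P^t* = 1%:M by apply/unitarymxP.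
rewrite (invmx_unitary Punit) in Beq.
have PP' : P^t* *m P = 1%:M by apply: mulmx1C.
pose a := Remx P; pose b := Immx P; pose d : 'rV[R]_n := Remx (spectral_diag B).
have ReP' : Remx (P^t*) = a^T by apply/matrixP => i j; rewrite !mxE; case: (P j i).
have ImP' : Immx (P^t*) = - b^T by apply/matrixP => i j; rewrite !mxE; case: (P j i).
have dE : diag_mx (spectral_diag B) = map_mx (real_complex R) (diag_mx d).
  rewrite map_diag_mx; congr diag_mx; apply/matrixP => i j; rewrite !mxE.
  by apply/esym/RRe_real/(mxOverP spR).
have ReR m p (X : 'M[R]_(m, p)) : Remx (map_mx (real_complex R) X) = X.
  by apply/matrixP => i j; rewrite !mxE.
have ImR m p (X : 'M[R]_(m, p)) : Immx (map_mx (real_complex R) X) = 0.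
  by apply/matrixP => i j; rewrite !mxE.
have Re1 : Remx (1%:M : 'M[R[i]]_n) = 1%:M.
  by rewrite -(map_mx1 (real_complex R)) ReR.
have DP : P *m B *m P^t* = diag_mx (spectral_diag B).
  by rewrite {1}Beq !mulmxA PP mul1mx -mulmxA PP mulmx1.
exists a, b, d; split.
- by rewrite -Re1 -PP' Remx_mul ReP' ImP' mulNmx opprK.
- by rewrite -Re1 -PP Remx_mul ReP' ImP' mulmxN opprK.
- rewrite -[RHS]ReR -/B Beq dE !Remx_mul Immx_mul ReP' ImP' ReR ImR.
  by rewrite !mulmx0 subr0 add0r !mulNmx opprK.
- rewrite -(ReR _ _ (diag_mx d)) -dE -DP !Remx_mul Immx_mul ReP' ImP' ReR ImR.
  by rewrite !mulmx0 subr0 add0r !mulmxN opprK.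
apply: prod_XsubC_eq; rewrite -charA; apply: (map_poly_inj (real_complex R)).
rewrite map_char_poly -/B Beq -(invmx_unitary Punit) char_poly_conj ?spectral_unit //.
rewrite char_poly_trig ?diag_mx_is_trig //.
rewrite big_map big_enum /=.
rewrite rmorph_prod; apply: eq_bigr => i _ /=.
rewrite rmorphB /= map_polyX map_polyC /= dE !mxE eqxx mulr1n.
by [].
Qed.

End SpectralFrame.

(** * Parseval frames and projections onto the bottom eigenspace *)

Section Projections.
Variables (R : realType) (n : nat).
Implicit Types u v w : 'I_n -> R.

Definition dot u v : R := \sum_j u j * v j.

Lemma cauchy_schwarz_sum (I : finType) (D : pred I) (x y : I -> R) :
  (\sum_(i | D i) x i * y i) ^+ 2 <= (\sum_(i | D i) x i ^+ 2) * (\sum_(i | D i) y i ^+ 2).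
Proof.
set X := \sum_(i | D i) x i ^+ 2; set Y := \sum_(i | D i) y i ^+ 2.
set Z := \sum_(i | D i) x i * y i.
have X0 : 0 <= X by apply: sumr_ge0 => i _; apply: sqr_ge0.
have quad (c : R) : 0 <= c ^+ 2 * X - 2 * c * Z + Y.
  have -> : c ^+ 2 * X - 2 * c * Z + Y = \sum_(i | D i) (c * x i - y i) ^+ 2.
    rewrite /X /Y /Z !mulr_sumr -sumrB -big_split /=; apply: eq_bigr => i _; ring.
  by apply: sumr_ge0 => i _; apply: sqr_ge0.
have [X_eq0|X_neq0] := eqVneq X 0.
  have Z0 : Z = 0.
    apply: big1 => i Di; have /eqP := X_eq0.
    rewrite /X psumr_eq0; last by move=> j _; apply: sqr_ge0.
    by move/allP/(_ i (mem_index_enum i)); rewrite Di /= sqrf_eq0 => /eqP->; rewrite mul0r.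
  by rewrite Z0 expr0n X_eq0 mul0r.
have Xp : 0 < X by rewrite lt_def X_neq0.
have := quad (Z / X).
have -> : (Z / X) ^+ 2 * X - 2 * (Z / X) * Z + Y = (X * Y - Z ^+ 2) / X by field.
by rewrite pmulr_lge0 ?invr_gt0 // subr_ge0.
Qed.

Lemma dotC u v : dot u v = dot v u.
Proof. by apply: eq_bigr => j _; rewrite mulrC. Qed.

Lemma dotBr u v w : dot u (fun j => v j - w j) = dot u v - dot u w.
Proof. by rewrite /dot -sumrB; apply: eq_bigr => j _; rewrite mulrBr. Qed.

Lemma dot_sumr (K : finType) u (c : K -> R) (h : K -> 'I_n -> R) :
  dot u (fun j => \sum_i c i * h i j) = \sum_i c i * dot u (h i).
Proof.
rewrite /dot; under eq_bigr do rewrite mulr_sumr.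
rewrite exchange_big /=; apply: eq_bigr => i _; rewrite mulr_sumr.
by apply: eq_bigr => j _; ring.
Qed.

Definition orthonormal_family (K : finType) (h : K -> 'I_n -> R) : Prop :=
  forall i j, dot (h i) (h j) = (i == j)%:R.

Definition residual (K : finType) (h : K -> 'I_n -> R) v : 'I_n -> R :=
  fun j => v j - \sum_i dot v (h i) * h i j.

Lemma dot_residual (K : finType) (h : K -> 'I_n -> R) u v :
  dot u (residual h v) = dot u v - \sum_i dot v (h i) * dot u (h i).
Proof. by rewrite dotBr dot_sumr. Qed.

Lemma residual_ortho (K : finType) (h : K -> 'I_n -> R) v i :
  orthonormal_family h -> dot (residual h v) (h i) = 0.
Proof.
move=> oh; rewrite dotC dot_residual (bigD1 i) //= big1 ?addr0; last first.
  by move=> j ji; rewrite oh eq_sym (negbTE ji) mulr0.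
by rewrite oh eqxx mulr1 dotC subrr.
Qed.

Lemma dot_residual_residual (K : finType) (h : K -> 'I_n -> R) u v :
  orthonormal_family h -> dot (residual h u) (residual h v) = dot (residual h u) v.
Proof.
move=> oh; rewrite dot_residual big1 ?subr0 // => i _.
by rewrite residual_ortho // mulr0.
Qed.

(* [f] is a Parseval frame; [T] selects the part of it that spans the bottom
   eigenspace. *)
Lemma residual_small (I K : finType) (f : I -> 'I_n -> R) (T : {set I})
    (h : K -> 'I_n -> R) (g : 'I_n -> R) (e1 e2 : R) :
  (forall v w, \sum_p dot (f p) v * dot (f p) w = dot v w) ->
  \sum_(p in T) dot (f p) (f p) <= #|K|%:R ->
  orthonormal_family h ->
  \sum_i \sum_(p in ~: T) dot (f p) (h i) ^+ 2 <= e2 ->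
  dot g g = 1 -> \sum_(p in ~: T) dot (f p) g ^+ 2 <= e1 ->
  1 - \sum_i dot g (h i) ^+ 2 <= 2 * (e1 + e2).
Proof.
move=> parseval fT oh he2 g1 ge1; set z := residual h g; set N := dot z z.
have NE : N = 1 - \sum_i dot g (h i) ^+ 2.
  rewrite /N dot_residual_residual // dotC dot_residual g1; congr (_ - _).
have sqN v : dot v v = \sum_j v j ^+ 2 by apply: eq_bigr => j _; rewrite expr2.
have N0 : 0 <= N by rewrite /N sqN; apply: sumr_ge0 => j _; apply: sqr_ge0.
have splitT F : \sum_p F p = \sum_(p in T) F p + \sum_(p in ~: T) F p :> R.
  rewrite (bigID (mem T)) /=; congr (_ + _); apply: eq_bigl => p; by rewrite inE.
(* Trace argument: [z] sees only the residuals of the [f p]. Over [T] their squared norms sum to at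
   most [#|K|] minus the mass of the [h i] on [T], which is at least [#|K| - e2]. *)
have zT : \sum_(p in T) dot (f p) z ^+ 2 <= N * e2.
  apply: (@le_trans _ _ (\sum_(p in T) N * (dot (f p) (f p) - \sum_i dot (f p) (h i) ^+ 2))).
    apply: ler_sum => p _.
    have -> : dot (f p) z = dot z (residual h (f p)).
      by rewrite /z dot_residual_residual // dotC.
    apply: le_trans (cauchy_schwarz_sum _ _ _) _.
    rewrite -!sqN -/N; apply: ler_wpM2l => //.
    by rewrite dot_residual_residual // dotC dot_residual.
  rewrite -mulr_sumr; apply: ler_wpM2l => //.
  rewrite sumrB [X in _ - X]exchange_big /=; apply: le_trans he2; rewrite lerBlDr. rewrite -big_split /=.
  apply: le_trans fT _; rewrite -sum1_card natr_sum; apply: ler_sum => i _.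
  rewrite addrC -splitT.
  have := oh i i; rewrite eqxx -parseval => <-.
  by apply: ler_sum => p _; rewrite expr2.
have gT : \sum_(p in T) dot (f p) g ^+ 2 <= 1.
  rewrite -g1 -parseval splitT.
  under [X in _ <= X + _]eq_bigr do rewrite -expr2.
  by rewrite lerDl; apply: sumr_ge0 => p _; rewrite -expr2 sqr_ge0.
have zT' : \sum_(p in ~: T) dot (f p) z ^+ 2 <= N.
  rewrite /N -parseval splitT.
  under [X in _ <= _ + X]eq_bigr do rewrite -expr2.
  by rewrite lerDr; apply: sumr_ge0 => p _; rewrite -expr2 sqr_ge0.
have e10 : 0 <= e1 by apply: le_trans ge1; apply: sumr_ge0 => p _; apply: sqr_ge0.
have sq0 (D : {set I}) v : 0 <= \sum_(p in D) dot (f p) v ^+ 2.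
  by apply: sumr_ge0 => p _; apply: sqr_ge0.
have NS : N = \sum_(p in T) dot (f p) z * dot (f p) g + \sum_(p in ~: T) dot (f p) z * dot (f p) g.
  by rewrite -splitT parseval /N dot_residual_residual.
have c1 := cauchy_schwarz_sum (mem T) (fun p => dot (f p) z) (fun p => dot (f p) g).
have c2 := cauchy_schwarz_sum (mem (~: T)) (fun p => dot (f p) z) (fun p => dot (f p) g).
simpl in c1, c2.
set x := \sum_(p in T) _ * _ in NS c1; set y := \sum_(p in ~: T) _ * _ in NS c2.
have x2 : x ^+ 2 <= N * e2.
  apply: le_trans c1 _; rewrite -[leRHS]mulr1; apply: ler_pM => //; exact: sq0.
have y2 : y ^+ 2 <= N * e1.
  by apply: le_trans c2 _; apply: ler_pM => //; exact: sq0.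
rewrite -NE; have [->|N_neq0] := eqVneq N 0.
  have : 0 <= e2 by apply: le_trans he2; apply: sumr_ge0 => i _; exact: sq0.
  lra.
have Np : 0 < N by rewrite lt_def N_neq0.
(* Here [N ^+ 2 = (x + y) ^+ 2], which is at most [2 * (x ^+ 2 + y ^+ 2)]; one factor [N]
   cancels. *)
rewrite -(ler_pM2l Np) -[N * N]expr2 {1}NS.
have : 0 <= (x - y) ^+ 2 by apply: sqr_ge0.
lra.
Qed.

Definition quad_form (A : 'M[R]_n) v : R := \sum_i \sum_j v i * A i j * v j.

(** [T] collects both rows of each eigenvalue strictly below [nth 0 l k]. The two rows of one
    eigenvalue have total squared norm [1], and at most [k] eigenvalues qualify, even with ties. *)
Lemma spectral_gap_frame (A : 'M[R]_n) (l : seq R) (k : nat) :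
  A^T = A -> is_spectrum A l -> (k < n)%N -> (forall v, 0 <= quad_form A v) ->
  exists (f : bool * 'I_n -> 'I_n -> R) (T : {set bool * 'I_n}),
  [/\ forall v w, \sum_p dot (f p) v * dot (f p) w = dot v w,
      \sum_(p in T) dot (f p) (f p) <= k%:R &
      forall v, nth 0 l k * (\sum_(p in ~: T) dot (f p) v ^+ 2) <= quad_form A v].
Proof.
move=> At spA kn psd; have [a [b [d [gram gram' AE dE perm_l]]]] := symmetric_frame At spA.
have [sorted_l _] := spA.
pose m c := if c : bool then a else b.
pose f (p : bool * 'I_n) := m p.1 p.2.
have sum_f (F : bool -> 'I_n -> R) : \sum_p F p.1 p.2 = \sum_t (F true t + F false t).
  by rewrite -(pair_big xpredT xpredT F) /= big_bool -big_split.
set lam := nth 0 l k.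
exists (fun p j => f p j), [set p : bool * 'I_n | d 0 p.2 < lam].
have d_ge0 t : 0 <= d 0 t.
  have := congr1 (fun M : 'M[R]_n => M t t) dE; rewrite !mxE eqxx mulr1n => <-.
  have h (M : 'M[R]_n) : (M *m A *m M^T) t t = quad_form A (M t).
    rewrite !mxE /quad_form exchange_big /=; apply: eq_bigr => j _.
    by rewrite !mxE mulr_suml.
  have := h a; rewrite mxE => ->; have := h b; rewrite mxE => ->.
  by rewrite addr_ge0.
have kern (D : 'rV[R]_n) v w : \sum_p D 0 p.2 * (dot (f p) v * dot (f p) w) =
   \sum_i \sum_j v i * (a^T *m diag_mx D *m a + b^T *m diag_mx D *m b) i j * w j.
  rewrite (sum_f (fun c t => D 0 t * (dot (m c t) v * dot (m c t) w))).
  transitivity (\sum_t \sum_i \sum_j v i * (D 0 t * (a t i * a t j + b t i * b t j)) * w j).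
    apply: eq_bigr => t _; rewrite /dot !mulr_suml !mulr_sumr -big_split /=.
    apply: eq_bigr => i _; rewrite !mulr_sumr -big_split /=.
    by apply: eq_bigr => j _; ring.
  rewrite exchange_big /=; apply: eq_bigr => i _; rewrite exchange_big /=; apply: eq_bigr => j _.
  rewrite mul_mx_diag mul_mx_diag !mxE -big_split /= mulr_sumr mulr_suml.
  by apply: eq_bigr => t _; rewrite !mxE; ring.
split.
- move=> v w; have := kern (const_mx 1) v w.
  rewrite diag_const_mx !mulmx1 gram => h.
  transitivity (\sum_p (const_mx 1 : 'rV[R]_n) 0 p.2 * (dot (f p) v * dot (f p) w)).
    by apply: eq_bigr => p _; rewrite mxE mul1r.
  rewrite h; apply: eq_bigr => i _; rewrite (bigD1 i) //= big1 ?addr0.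
    by rewrite mxE eqxx mulr1.
  by move=> j ji; rewrite mxE eq_sym (negbTE ji) mulr0 mul0r.
- rewrite big_mkcond /=.
  rewrite (eq_bigr (fun p : bool * 'I_n => if d 0 p.2 < lam then dot (m p.1 p.2) (m p.1 p.2) else 0));
    last by move=> p _; rewrite inE.
  rewrite (sum_f (fun c t => if d 0 t < lam then dot (m c t) (m c t) else 0)).
  rewrite (eq_bigr (fun t => (d 0 t < lam)%R%:R)); last first.
    move=> t _; case: ifP => _; last by rewrite addr0.
    have := congr1 (fun M : 'M[R]_n => M t t) gram'; rewrite !mxE eqxx mulr1n /dot => <-.
    by congr (_ + _); apply: eq_bigr => j _; rewrite !mxE.
  rewrite -natr_sum ler_nat.
  have -> : (\sum_(t < n) (d 0%R t < lam)%R = count (fun x => (x < lam)%R) l)%N.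
    rewrite (seq.permP perm_l) count_map -sum1_count [RHS]big_mkcond /= big_enum /=.
    by apply: eq_bigr => t _; case: (d 0 t < lam).
  have szl : (k <= size l)%N by rewrite (perm_size perm_l) size_map size_enum_ord ltnW.
  rewrite -(cat_take_drop k l) count_cat.
  rewrite (_ : count _ (drop k l) = 0%N) ?addn0.
    by apply: leq_trans (count_size _ _) _; rewrite size_take_min; apply: geq_minl.
  apply/eqP; rewrite -leqn0 leqNgt -has_count; apply/negP => h.
  have /(has_nthP 0) := h; case=> i.
  rewrite size_drop ltn_subRL => il; rewrite nth_drop ltNge; apply/negP; rewrite negbK.
  apply: (sorted_leq_nth le_trans le_refl 0 sorted_l); rewrite ?inE ?leq_addr //.
  exact: leq_ltn_trans (leq_addr _ _) il.
- move=> v; rewrite [leRHS](_ : _ = \sum_p d 0 p.2 * (dot (f p) v * dot (f p) v)); last first.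
    by rewrite kern AE.
  rewrite mulr_sumr big_mkcond /=; apply: ler_sum => p _.
  rewrite !inE -leNgt; case: ifP => [h|_]; first by rewrite -expr2 ler_wpM2r ?sqr_ge0.
  by rewrite mulr_ge0 // -expr2 sqr_ge0.
Qed.

End Projections.

(** * Matching the parts of two families by their overlaps *)

Section Matching.
Variables (R : realFieldType) (k : nat) (m : 'I_k -> 'I_k -> R) (e : R).
Let x i := \sum_j m i j.
Let y j := \sum_i m i j.
Hypotheses (m_ge0 : forall i j, 0 <= m i j) (x_gt0 : forall i, 0 < x i)
  (y_gt0 : forall j, 0 < y j) (e_ge0 : 0 <= e) (e_small : 4 * e <= 1)
  (overlap : forall i, 1 - \sum_j m i j ^+ 2 / (x i * y j) <= e).

(** The average of [m i j / y j] with weights [m i j / x i] is at least [1 - e], so row [i] owns a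
    fraction [1 - e] of some column. No column has two such owners, as [2 * (1 - e)] exceeds [1];
    this gives the permutation. *)
Lemma matching : exists sg : 'S_k, forall i,
  (x i - m i (sg i)) + (y (sg i) - m i (sg i)) <= 4 * e * x i.
Proof.
have e1 : 0 < 1 - 2 * e by have := e_small; have := e_ge0; lra.
have my i j : m i j <= y j.
  by rewrite /y (bigD1 i) //= lerDl; apply: sumr_ge0.
have mx i j : m i j <= x i.
  by rewrite /x (bigD1 j) //= lerDl; apply: sumr_ge0.
have best i : exists j, (1 - e) * y j <= m i j.
  apply/existsP; apply/contraT; rewrite negb_exists => /forallP h.
  have : \sum_j m i j ^+ 2 / (x i * y j) < 1 - e.
    have -> : 1 - e = \sum_j (1 - e) * (m i j / x i).
      by rewrite -mulr_sumr -mulr_suml -/(x i) divff ?mulr1 // gt_eqF.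
    have h' j : m i j ^+ 2 / (x i * y j) <= (1 - e) * (m i j / x i).
      have := h j; rewrite -ltNge => /ltW hj.
      have -> : m i j ^+ 2 / (x i * y j) = m i j / x i * (m i j / y j).
        by field; rewrite !gt_eqF.
      rewrite mulrC; apply: ler_wpM2r; first by rewrite divr_ge0 // ltW.
      by rewrite ler_pdivrMr // ltW.
    have [j mj] : exists j, 0 < m i j.
      apply/existsP; apply/contraT; rewrite negb_exists => /forallP m0.
      have := x_gt0 i; rewrite /x big1 ?ltxx // => j _.
      by apply/eqP; rewrite eq_le m_ge0 andbT leNgt m0.
    rewrite (bigD1 j) //= [ltRHS](bigD1 j) //=; apply: ltr_leD; last exact: ler_sum.
    have := h j; rewrite -ltNge => hj.
    have -> : m i j ^+ 2 / (x i * y j) = m i j / x i * (m i j / y j).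
      by field; rewrite !gt_eqF.
    rewrite mulrC ltr_pM2r ?divr_gt0 //.
    by rewrite ltr_pdivrMr.
  have := overlap i; lra.
have sgP i : exists j, (1 - e) * y j <= m i j by apply: best.
pose sg0 i := xchoose (sgP i).
have sg0P i : (1 - e) * y (sg0 i) <= m i (sg0 i) by apply: (xchooseP (sgP i)).
have two i i' j : i != i' -> m i j + m i' j <= y j.
  move=> ii; rewrite /y (bigD1 i) //= (bigD1 i') //=; last by rewrite eq_sym.
  by rewrite addrA lerDl; apply: sumr_ge0.
have sg_inj : injective sg0.
  move=> i i' eqs; apply/eqP/contraT => ii.
  have h1 := sg0P i; have h2 := sg0P i'; rewrite -eqs in h2.
  have h3 := two i i' (sg0 i) ii.
  have h4 := mulr_gt0 e1 (y_gt0 (sg0 i)).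
  by suff : False by []; lra.
exists (perm sg_inj) => i; rewrite permE; set j := sg0 i.
(* Every other column is owned by another row, which leaves at most a fraction [e] of it to row
   [i]. *)
have other j' : j' != j -> m i j' <= e * y j'.
  move=> jj; pose i' := (perm sg_inj)^-1%g j'.
  have ij : sg0 i' = j' by rewrite -(permE sg_inj) permKV.
  have ii : i != i' by apply: contraNneq jj => eii; rewrite /j eii ij.
  have := two i i' j' ii; have := sg0P i'; rewrite ij; lra.
have hx : (1 - e) * x i <= m i j + e * (x i - m i j).
  have -> : (1 - e) * x i = x i * (1 - e) by rewrite mulrC.
  rewrite -ler_pdivlMl //; apply: le_trans (_ : \sum_j' m i j' ^+ 2 / (x i * y j') <= _).
    have := overlap i; lra.
  rewrite ler_pdivlMl // mulr_sumr (bigD1 j) //=; apply: lerD.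
    have -> : x i * (m i j ^+ 2 / (x i * y j)) = m i j * (m i j / y j).
      by field; rewrite !gt_eqF.
    rewrite -[leRHS]mulr1; apply: ler_wpM2l => //.
    by rewrite ler_pdivrMr // mul1r.
  have -> : x i - m i j = \sum_(j' | j' != j) m i j'.
    by rewrite /x (bigD1 j) //= addrAC subrr add0r.
  rewrite mulr_sumr; apply: ler_sum => j' jj.
  have -> : x i * (m i j' ^+ 2 / (x i * y j')) = m i j' * (m i j' / y j').
    by field; rewrite !gt_eqF.
  rewrite mulrC; apply: ler_wpM2r => //.
  by rewrite ler_pdivrMr // other.
have := sg0P i; rewrite -/j => hj.
have := x_gt0 i; have := y_gt0 j; have := mx i j => ? ? ?.
have yx : y j <= 2 * x i by nra.
have h1 : x i - m i j <= 2 * e * x i.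
  have h : (1 - e) * (x i - m i j) <= e * x i by lra.
  nra.
have h2 : y j - m i j <= 2 * e * x i by nra.
lra.
Qed.

End Matching.

(** * Normalized indicators and the quadratic form of the Laplacian *)

Section Graph.
Variables (R : realType) (n : nat) (w : R) (W : 'M[R]_n).
Hypothesis W_graph : weighted_graph w W.
Implicit Types (u v : 'I_n) (S : {set 'I_n}).

Lemma weight_sym u v : W u v = W v u.
Proof. by have [Wt _ _] := W_graph; rewrite -[in LHS]Wt mxE. Qed.

Lemma weight_ge0 u v : 0 <= W u v.
Proof.
have [_ _ W1] := W_graph; have [->//|/W1/andP[h _]] := eqVneq (W u v) 0.
exact: le_trans h.
Qed.

Lemma degree_ge0 u : 0 <= degree W u.
Proof. by apply: sumr_ge0 => v _; apply: weight_ge0. Qed.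

Lemma weight_le_degree u v : W u v <= degree W u.
Proof. by rewrite /degree (bigD1 v) //= lerDl; apply: sumr_ge0 => i _; apply: weight_ge0. Qed.

Lemma degree_eq0 u v : degree W u = 0 -> W u v = 0.
Proof. by move=> d0; apply/eqP; rewrite eq_le weight_ge0 -d0 weight_le_degree. Qed.

Lemma degree_ge1 u : degree W u != 0 -> 1 <= degree W u.
Proof.
move=> d0; have [v Wv] : exists v, W u v != 0.
  apply/existsP; apply: contraNT d0; rewrite negb_exists => /forallP h.
  by apply/eqP; apply: big1 => v _; apply/eqP; rewrite -[_ == _]negbK.
have [_ _ W1] := W_graph; have /andP[h _] := W1 _ _ Wv.
exact: le_trans h (weight_le_degree _ _).
Qed.

Lemma vol_ge0 (S : {set 'I_n}) : 0 <= vol W S.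
Proof. by apply: sumr_ge0 => u _; apply: degree_ge0. Qed.

Definition cut_weight (S : {set 'I_n}) : R := \sum_(u in S) \sum_(v in ~: S) W u v.

Lemma cut_weight_ge0 S : 0 <= cut_weight S.
Proof. by apply: sumr_ge0 => u _; apply: sumr_ge0 => v _; apply: weight_ge0. Qed.

Lemma cut_weight_le_vol S : cut_weight S <= vol W S.
Proof.
apply: ler_sum => u _; rewrite [leRHS](bigID (mem (~: S))) /=.
by rewrite lerDl; apply: sumr_ge0 => v _; apply: weight_ge0.
Qed.

Let y (v : 'I_n -> R) u : R := v u / Num.sqrt (degree W u).

Lemma quad_form_laplacian (v : 'I_n -> R) :
  quad_form (normalized_laplacian W) v =
  2^-1 * \sum_u \sum_u' W u u' * (y v u - y v u') ^+ 2.
Proof.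
have -> : \sum_u \sum_u' W u u' * (y v u - y v u') ^+ 2 =
    2 * (\sum_u degree W u * y v u ^+ 2 - \sum_u \sum_u' y v u * W u u' * y v u').
  transitivity (\sum_u \sum_u' W u u' * y v u ^+ 2 + \sum_u \sum_u' W u u' * y v u' ^+ 2
      - 2 * \sum_u \sum_u' y v u * W u u' * y v u').
    rewrite mulr_sumr -big_split -sumrB; apply: eq_bigr => u _ /=.
    rewrite mulr_sumr -big_split -sumrB; apply: eq_bigr => u' _ /=; ring.
  have e1 : \sum_u \sum_u' W u u' * y v u ^+ 2 = \sum_u degree W u * y v u ^+ 2.
    by apply: eq_bigr => u _; rewrite mulr_suml.
  have e2 : \sum_u \sum_u' W u u' * y v u' ^+ 2 = \sum_u degree W u * y v u ^+ 2.
    rewrite -e1 exchange_big; apply: eq_bigr => u _; apply: eq_bigr => u' _.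
    by rewrite weight_sym.
  by rewrite e1 e2; ring.
rewrite mulrA mulVf ?pnatr_eq0 // mul1r -sumrB; apply: eq_bigr => u _.
transitivity (\sum_u' (degree W u * y v u ^+ 2 *+ (u' == u) - y v u * W u u' * y v u')); last first.
  rewrite sumrB (bigD1 u) //= eqxx mulr1n big1 ?addr0 // => u' /negbTE ->.
  by rewrite mulr0n.
apply: eq_bigr => u' _.
rewrite /normalized_laplacian mul_mx_diag mul_diag_mx !mxE /y eq_sym.
by case: eqVneq => [->|_]; rewrite ?mulr1n ?mulr0n; ring.
Qed.

Lemma normalized_laplacian_psd (v : 'I_n -> R) : 0 <= quad_form (normalized_laplacian W) v.
Proof.
rewrite quad_form_laplacian mulr_ge0 ?invr_ge0 //.
apply: sumr_ge0 => u _; apply: sumr_ge0 => u' _.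
by rewrite mulr_ge0 ?weight_ge0 ?sqr_ge0.
Qed.

Lemma normalized_laplacian_sym : (normalized_laplacian W)^T = normalized_laplacian W.
Proof.
apply/matrixP => u v; rewrite mxE /normalized_laplacian !mul_mx_diag !mul_diag_mx !mxE.
by rewrite eq_sym (weight_sym v u); case: eqVneq => [->|_]; rewrite ?mulr1n ?mulr0n; ring.
Qed.

(* Isolated vertices are given a small positive weight [eta], so that the
   normalized indicator of a part of volume zero is still a unit vector. *)
Variable eta : R.
Hypothesis eta_gt0 : 0 < eta.

Definition vertex_weight u : R := if degree W u == 0 then eta else degree W u.
Definition pvol (S : {set 'I_n}) : R := \sum_(u in S) vertex_weight u.
Definition indicator (S : {set 'I_n}) u : R :=
  (u \in S)%:R * Num.sqrt (vertex_weight u) / Num.sqrt (pvol S).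

Lemma vertex_weight_gt0 u : 0 < vertex_weight u.
Proof. by rewrite /vertex_weight; case: eqVneq => // d0; rewrite lt_def d0 degree_ge0. Qed.

Lemma pvol_ge0 S : 0 <= pvol S.
Proof. by apply: sumr_ge0 => u _; apply/ltW/vertex_weight_gt0. Qed.

Lemma pvol_gt0 S : S != finset.set0 -> 0 < pvol S.
Proof.
case/set0Pn => u uS; rewrite /pvol (bigD1 u) //=; apply: ltr_wpDr; last exact: vertex_weight_gt0.
by apply: sumr_ge0 => v _; apply/ltW/vertex_weight_gt0.
Qed.

Lemma vol_le_pvol S : vol W S <= pvol S.
Proof.
apply: ler_sum => u _; rewrite /vertex_weight -/(degree W u).
by case: eqVneq => // ->; apply: ltW.
Qed.

Lemma pvol_le_vol S : pvol S <= vol W S + eta * n%:R.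
Proof.
apply: (@le_trans _ _ (\sum_(u in S) (degree W u + eta))).
  apply: ler_sum => u _; rewrite /vertex_weight.
  by case: eqVneq => [->|_]; rewrite ?add0r // lerDl ltW.
rewrite big_split /=; apply: lerD => //; rewrite sumr_const -[eta *+ _]mulr_natr.
apply: ler_wpM2l; first exact: ltW.
rewrite ler_nat.
by rewrite -[X in (_ <= X)%N](card_ord n) max_card.
Qed.

Lemma dot_indicator S S' : dot (indicator S) (indicator S') =
  pvol (S :&: S') / (Num.sqrt (pvol S) * Num.sqrt (pvol S')).
Proof.
rewrite /pvol mulr_suml big_mkcond /=; apply: eq_bigr => u _.
rewrite /indicator inE; have sq := sqr_sqrtr (ltW (vertex_weight_gt0 u)).
case: (u \in S); case: (u \in S'); rewrite /= ?mul0r ?mulr0 // !mul1r -[in RHS]sq invfM.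
by ring.
Qed.

Lemma dot_indicator_sqr S S' : dot (indicator S) (indicator S') ^+ 2 =
  pvol (S :&: S') ^+ 2 / (pvol S * pvol S').
Proof. by rewrite dot_indicator expr_div_n exprMn !sqr_sqrtr ?pvol_ge0. Qed.

Lemma dot_indicator_self S : S != finset.set0 -> dot (indicator S) (indicator S) = 1.
Proof.
by move=> S0; rewrite dot_indicator finset.setIid -expr2 sqr_sqrtr ?pvol_ge0 // divff // gt_eqF // pvol_gt0.
Qed.

Lemma cut_weight_indicator S :
  \sum_u \sum_v W u v * ((u \in S)%:R - (v \in S)%:R) ^+ 2 = 2 * cut_weight S.
Proof.
transitivity (\sum_u \sum_v (W u v * ((u \in S) && (v \notin S))%:R
                            + W u v * ((v \in S) && (u \notin S))%:R)).
  apply: eq_bigr => u _; apply: eq_bigr => v _.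
  by case: (u \in S); case: (v \in S) => /=; ring.
have e1 : \sum_u \sum_v W u v * ((u \in S) && (v \notin S))%:R = cut_weight S.
  rewrite /cut_weight [RHS]big_mkcond /=; apply: eq_bigr => u _; case: (u \in S) => /=.
    by rewrite [RHS]big_mkcond /=; apply: eq_bigr => v _; rewrite inE; case: (v \in S); rewrite ?mulr0 ?mulr1.
  by apply: big1 => v _; rewrite mulr0.
have e2 : \sum_u \sum_v W u v * ((v \in S) && (u \notin S))%:R = cut_weight S.
  rewrite -e1 exchange_big; apply: eq_bigr => u _; apply: eq_bigr => v _.
  by rewrite weight_sym.
under eq_bigr do rewrite big_split /=.
by rewrite big_split /= e1 e2; ring.
Qed.

Lemma quad_form_indicator S : S != finset.set0 ->
  quad_form (normalized_laplacian W) (indicator S) = cut_weight S / pvol S.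
Proof.
move=> S0; have p0 := pvol_gt0 S0.
have sp0 : Num.sqrt (pvol S) != 0 by rewrite gt_eqF // sqrtr_gt0.
rewrite quad_form_laplacian.
transitivity (2^-1 * \sum_u \sum_v W u v * ((u \in S)%:R - (v \in S)%:R) ^+ 2 / pvol S).
  congr (_ * _); apply: eq_bigr => u _; apply: eq_bigr => v _.
  have [->|Wuv] := eqVneq (W u v) 0; first by rewrite !mul0r.
  have yE x x' : W x x' != 0 -> y (indicator S) x = (x \in S)%:R / Num.sqrt (pvol S).
    move=> Wx; have dx : degree W x != 0.
      by apply: contraNneq Wx => /degree_eq0 ->.
    have sd : Num.sqrt (degree W x) != 0 by rewrite gt_eqF // sqrtr_gt0 lt_def dx degree_ge0.
    by rewrite /y /indicator /vertex_weight (negbTE dx); field; rewrite sp0 sd.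
  rewrite (yE u v Wuv) (yE v u); last by rewrite weight_sym.
  by rewrite -mulrBl expr_div_n sqr_sqrtr ?pvol_ge0 // mulrA.
under eq_bigr do rewrite -mulr_suml.
rewrite -mulr_suml cut_weight_indicator.
by field; rewrite gt_eqF.
Qed.

(** Passing from [vol] to the larger [pvol] only lowers the quotient; if the volume vanishes, so
    does the cut and both sides are [0]. *)
Lemma rayleigh_le_conductance S : S != finset.set0 ->
  quad_form (normalized_laplacian W) (indicator S) <= conductance W S.
Proof.
move=> S0; rewrite quad_form_indicator // /conductance -/(cut_weight S).
have [v0|v0] := eqVneq (vol W S) 0.
  have -> : cut_weight S = 0.
    by apply/eqP; rewrite eq_le cut_weight_ge0 andbT -v0 cut_weight_le_vol.
  by rewrite !mul0r.
apply: ler_wpM2l; first exact: cut_weight_ge0.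
rewrite lef_pV2 ?posrE ?vol_le_pvol ?pvol_gt0 //.
by rewrite lt_def v0 vol_ge0.
Qed.

Section Partition.
Variables (k : nat) (A : {ffun 'I_k -> {set 'I_n}}).
Hypothesis A_part : kway_partition A.

Lemma kway_nonempty i : A i != finset.set0.
Proof. by case/and3P: A_part => /forallP h _ _; apply: h. Qed.

Lemma kway_disjoint i j : i != j -> A i :&: A j = finset.set0.
Proof.
case/and3P: A_part => _ /forallP h _ ij; apply/eqP; rewrite finset.setI_eq0.
by have /forallP/(_ j)/implyP := h i; apply.
Qed.

Lemma kway_cover u : \sum_i (u \in A i)%:R = 1 :> R.
Proof.
case/and3P: (A_part) => _ _ /eqP/finset.setP/(_ u); rewrite !inE => /bigcupP[i _ ui].
rewrite (bigD1 i) //= ui big1 ?addr0 // => j ji.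
have := kway_disjoint ji => /finset.setP/(_ u); rewrite !inE ui andbT.
by move=> ->.
Qed.

Lemma sum_pvol_kway S : \sum_i pvol (S :&: A i) = pvol S.
Proof.
transitivity (\sum_i \sum_(u in S) (u \in A i)%:R * vertex_weight u).
  apply: eq_bigr => i _; rewrite /pvol big_mkcond [RHS]big_mkcond /=; apply: eq_bigr => u _.
  by rewrite inE; case: (u \in S); case: (u \in A i); rewrite ?mul0r ?mul1r.
rewrite exchange_big; apply: eq_bigr => u _.
by rewrite -mulr_suml kway_cover mul1r.
Qed.

Lemma kway_orthonormal : orthonormal_family (fun i => indicator (A i)).
Proof.
move=> i j; have [->|ij] := eqVneq i j; first by rewrite dot_indicator_self ?kway_nonempty.
by rewrite dot_indicator kway_disjoint // /pvol big_set0 mul0r.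
Qed.

End Partition.

Lemma pvol_symdiff S S' :
  pvol (symdiff S S') = (pvol S' - pvol (S' :&: S)) + (pvol S - pvol (S' :&: S)).
Proof.
have E X : pvol X = \sum_u (u \in X)%:R * vertex_weight u.
  rewrite /pvol big_mkcond; apply: eq_bigr => u _.
  by case: (u \in X); rewrite ?mul1r ?mul0r.
rewrite !E -!sumrB -big_split /=; apply: eq_bigr => u _.
by rewrite !inE; case: (u \in S); case: (u \in S') => /=; ring.
Qed.


Lemma expansion_ge0 k : 0 <= expansion W k.
Proof.
rewrite /expansion; elim/big_ind: _ => // [x z x0 z0|A _].
  by rewrite le_min x0 z0.
exact: bigmax_ge_id.
Qed.

Lemma conductance_le_max k (A : {ffun 'I_k -> {set 'I_n}}) i :
  conductance W (A i) <= max_conductance W A.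
Proof. exact: (le_bigmax 0 (fun i => conductance W (A i))). Qed.

End Graph.

(* Both families of normalized indicators are almost contained in the space
   spanned by the bottom [k] eigenvectors, and are therefore close to each
   other. *)
Lemma partition_stability (R : realType) (n k : nat) (w c : R) (W : 'M[R]_n) (l : seq R)
    (A P : {ffun 'I_k -> {set 'I_n}}) :
  weighted_graph w W -> is_spectrum (normalized_laplacian W) l -> (0 < k < n)%N ->
  kway_partition A -> kway_partition P -> 1 <= c ->
  max_conductance W A <= c * max_conductance W P ->
  0 < nth 0 l k ->
  32 * c * k%:R * max_conductance W P <= nth 0 l k ->
  exists sg : 'S_k, forall i, vol W (symdiff (A (sg i)) (P i)) <=
    32 * c * k%:R * (max_conductance W P / nth 0 l k) * vol W (P i).
Proof.
move=> Wg spl /andP[k0 kn] Ap Pp c1 cA lam0 small.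
set lam := nth 0 l k in lam0 small *; set rho := max_conductance W P in cA small *.
set x := rho / lam.
have n0 : 0 < n%:R :> R by rewrite ltr0n; apply: leq_trans kn.
have k1 : 1 <= k%:R :> R by rewrite ler1n.
(* The weight added to isolated vertices totals at most [1], the least degree of the other
   vertices. *)
pose eta : R := n%:R^-1; have eta0 : 0 < eta by rewrite invr_gt0.
have en : eta * n%:R = 1 by rewrite mulVf // gt_eqF.
have rho0 : 0 <= rho.
  apply: le_trans (conductance_le_max W P (Ordinal k0)).
  by rewrite divr_ge0 ?(cut_weight_ge0 Wg) ?(vol_ge0 Wg).
have x0 : 0 <= x by rewrite divr_ge0 // ltW.
have xs : 32 * c * k%:R * x <= 1 by rewrite /x mulrA ler_pdivrMr // mul1r.
have [f [T [parseval fT gap]]] := spectral_gap_frame (normalized_laplacian_sym Wg) spl kn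
  (normalized_laplacian_psd Wg).
have tail B (S : {set 'I_n}) : S != finset.set0 -> conductance W S <= B ->
    \sum_(p in ~: T) dot (f p) (indicator W eta S) ^+ 2 <= B / lam.
  move=> S0 SB; rewrite ler_pdivlMr // mulrC.
  apply: le_trans (gap _) _; apply: le_trans SB.
  exact: (rayleigh_le_conductance Wg eta0).
(* One indicator of [P] has mass at most [x] outside [T], and each of the [k] indicators of [A] at
   most [c * x]. *)
pose e := 2 * (x + k%:R * (c * x)).
have ex : e <= 4 * c * k%:R * x.
  have : 1 * x <= k%:R * c * x by apply: ler_wpM2r => //; nra.
  by rewrite /e; lra.
have c0 : 0 <= c by lra.
have e0 : 0 <= e by apply: mulr_ge0 => //; apply: addr_ge0 => //; do 2!apply: mulr_ge0 => //.
pose m i j := pvol W eta (P i :&: A j).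
have rowE i : \sum_j m i j = pvol W eta (P i) by apply: sum_pvol_kway.
have colE j : \sum_i m i j = pvol W eta (A j).
  rewrite -(sum_pvol_kway W eta Pp); apply: eq_bigr => i _.
  by rewrite /m finset.setIC.
have [] := @matching R k m e.
- by move=> i j; apply: (pvol_ge0 Wg eta0).
- by move=> i; rewrite rowE; apply: (pvol_gt0 Wg eta0); apply: kway_nonempty.
- by move=> j; rewrite colE; apply: (pvol_gt0 Wg eta0); apply: kway_nonempty.
- exact: e0.
- lra.
- move=> i; rewrite /e.
  have := @residual_small R n _ 'I_k f T (fun j => indicator W eta (A j))
    (indicator W eta (P i)) x (k%:R * (c * x)).
  rewrite card_ord => /(_ parseval fT) h; apply: le_trans (h _ _ _ _).
  + rewrite lerD2l lerN2; apply: ler_sum => j _.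
    by rewrite (dot_indicator_sqr Wg eta0) rowE colE.
  + exact: (kway_orthonormal Wg eta0).
  + apply: (@le_trans _ _ (\sum_(j < k) c * x)); last by rewrite sumr_const card_ord mulr_natl.
    apply: ler_sum => j _; rewrite /x mulrA; apply: tail; first exact: kway_nonempty.
    exact: le_trans (conductance_le_max W A j) cA.
  + by apply: (dot_indicator_self Wg eta0); apply: kway_nonempty.
  + apply: tail; [exact: kway_nonempty | exact: conductance_le_max].
move=> sg hsg; exists sg => i; have := hsg i; rewrite rowE colE -(pvol_symdiff W eta) => h.
have hx : pvol W eta (symdiff (A (sg i)) (P i)) <= 16 * c * k%:R * x * pvol W eta (P i).
  apply: le_trans h _; apply: ler_wpM2r; first exact: (pvol_ge0 Wg eta0).
  lra.
have pv := pvol_le_vol W eta0 (P i); rewrite en in pv.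
have ckx0 : 0 <= c * k%:R * x by do 2!apply: mulr_ge0 => //.
(* If [P i] has volume zero, a vertex of nonzero degree in the symmetric difference would give it
   [pvol] at least [1], against a bound of [2^-1]. *)
have [v0|v0] := eqVneq (vol W (P i)) 0.
  rewrite v0 mulr0; apply: contraT; rewrite -ltNge => vpos.
  have [u uD du] : exists2 u, u \in symdiff (A (sg i)) (P i) & degree W u != 0.
    apply/exists_inP; apply: contraTT vpos; rewrite negb_exists_in => /forall_inP h0.
    by rewrite -leNgt /vol big1 // => u /h0; rewrite negbK => /eqP.
  have : 1 <= pvol W eta (symdiff (A (sg i)) (P i)).
    apply: le_trans (degree_ge1 Wg du) _; rewrite /pvol (bigD1 u) //=.
    rewrite {1}/vertex_weight (negbTE du) lerDl; apply: sumr_ge0 => u' _.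
    exact/ltW/(vertex_weight_gt0 Wg eta0).
  rewrite v0 add0r in pv.
  have pv0 := pvol_ge0 Wg eta0 (P i).
  have : 16 * c * k%:R * x * pvol W eta (P i) <= 2^-1 * 1 by apply: ler_pM => //; lra.
  by move=> h1 h2; suff : False by []; lra.
(* Hence [pvol] of [P i] is at most twice its volume, which turns the constant [16] into [32]. *)
have v1 : 1 <= vol W (P i).
  have [u uP du] : exists2 u, u \in P i & degree W u != 0.
    apply/exists_inP; apply: contraNT v0; rewrite negb_exists_in => /forall_inP h0.
    by rewrite /vol big1 // => u /h0; rewrite negbK => /eqP.
  apply: le_trans (degree_ge1 Wg du) _; rewrite /vol (bigD1 u) //= -/(degree W u).
  by rewrite lerDl; apply: sumr_ge0 => u' _; apply: (degree_ge0 Wg).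
apply: le_trans (vol_le_pvol W eta0 _) _; apply: le_trans hx _.
have -> : 32 * c * k%:R * x * vol W (P i) = 16 * c * k%:R * x * (2 * vol W (P i)) by ring.
apply: ler_wpM2l; lra.
Qed.

(** * Reconstruction of a partition from approximate cuts *)

Lemma close_partition_of_conductance (R : realType) (n k : nat) (w c : R) (W : 'M[R]_n)
    (A P : {ffun 'I_k -> {set 'I_n}}) :
  weighted_graph w W -> (0 < k < n)%N -> kway_partition A -> optimal_partition W P ->
  1 <= c -> max_conductance W A <= c * max_conductance W P ->
  ((32 * c * k%:R ^+ 3)%:E <= upsilon W k)%E ->
  close_partition W (32 * c) A P.
Proof.
move=> Wg kn Ap [Pp PE] c1 cA.
have k1 : 1 <= k%:R :> R by rewrite ler1n; case/andP: kn.
have k3 : k%:R <= k%:R ^+ 3 :> R by rewrite -[leLHS]expr1; apply: ler_weXn2l.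
rewrite /close_partition /upsilon -PE; set rho := max_conductance W P in cA *.
have rho0 : 0 <= rho by rewrite /rho PE expansion_ge0.
set l := eigenvalues _; have spl : is_spectrum (normalized_laplacian W) l.
  have [l0 h0] := symmetric_is_spectrum (normalized_laplacian_sym Wg).
  exact: (@xgetPex _ [::] [set l | is_spectrum (normalized_laplacian W) l]%classic (ex_intro _ l0 h0)).
set lam := nth 0 l k => h.
have a0 : 0 < 32 * c * k%:R ^+ 3 by nra.
(* For [lam <= 0] the ratio is nonpositive: [0] or [-oo] when [rho = 0], an ordinary quotient
   otherwise. This contradicts the positive lower bound. *)
have lam_gt0 : 0 < lam.
  rewrite ltNge; apply/negP => lam_le0; have [r0|r0] := eqVneq rho 0; last first.
    move: h; rewrite inver (negbTE r0) -EFinM lee_fin => h.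
    have : lam / rho <= 0 by rewrite pmulr_lle0 // invr_gt0 lt_def r0.
    lra.
  move: h; rewrite r0 inver eqxx; have [l0|l0] := eqVneq lam 0.
    by rewrite l0 mul0e lee_fin leNgt a0.
  by rewrite lt0_muley ?lte_fin ?lt_def ?(eq_sym 0) ?l0.
(* When [rho = 0] the ratio is [+oo] and its inverse [0] still equals [rho / lam]. *)
have [inv_le rho_small] : (((lam%:E / rho%:E)^-1)%E = (rho / lam)%:E :> \bar R) /\
   (32 * c * k%:R ^+ 3 * rho <= lam).
  have [r0|r0] := eqVneq rho 0.
    rewrite r0 inver eqxx gt0_muley ?lte_fin // invey mul0r; split => //.
    by rewrite mulr0 ltW.
  rewrite inver (negbTE r0) -EFinM inver mulf_eq0 invr_eq0 (negbTE r0) orbF gt_eqF //.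
  split; first by rewrite invf_div.
  move: h; rewrite inver (negbTE r0) -EFinM lee_fin ler_pdivlMr //.
  by rewrite lt_def r0.
have small : 32 * c * k%:R * rho <= lam.
  apply: le_trans rho_small; apply: ler_wpM2r => //; apply: ler_wpM2l => //; lra.
have [sg hsg] := partition_stability Wg spl kn Ap Pp c1 cA lam_gt0 small.
apply/existsP; exists sg; apply/forallP => i.
rewrite inv_le -!EFinM lee_fin; apply: le_trans (hsg i) _.
apply: ler_wpM2r; first exact: vol_ge0 Wg _.
apply: ler_wpM2r; first by rewrite divr_ge0 // ltW.
by apply: ler_wpM2l => //; lra.
Qed.

Section WeightClasses.
Variables (R : realType) (n J : nat).

Let V := ('I_n * 'I_J)%type.

(* The edges of weight in [2^j, 2^(j+1)) are placed on the [j]-th copy of the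
   vertex set, which makes the graph unweighted. *)
Definition class_edges (W : 'M[R]_n) : {set V * V} :=
  [set e : V * V | [&& e.1.2 == e.2.2, (e.1.1 < e.2.1)%N &
     2 ^+ e.1.2 <= W e.1.1 e.2.1 < 2 ^+ e.1.2.+1]].

Lemma class_edges_covers s (W : 'M[R]_n) (D : placement n s) : covers W D ->
  forall e, (e \in class_edges W) = [exists i, e \in class_edges (local_graph W D i)].
Proof.
move=> /eqP cov [[u j] [v j']]; rewrite inE /=.
have pos (a : R) (m : nat) : 2 ^+ m <= a -> a != 0.
  by move=> h; rewrite gt_eqF // (lt_le_trans _ h) // exprn_gt0.
apply/idP/existsP => [/and3P[/eqP jj uv Wj]|[i]].
  have : (u, v) \in edge_set W by rewrite inE /= uv; case/andP: Wj => /pos->.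
  rewrite -cov => /bigcupP[i _ uvi]; exists i.
  by rewrite inE /= jj eqxx uv mxE uvi -jj Wj.
rewrite inE /= => /and3P[-> uv]; rewrite uv mxE; case: ifP => // _ /andP[/pos].
by rewrite eqxx.
Qed.

(** [x] rounded down to a power of two, for [x] in the range of the [J] classes. *)
Definition pair_weight (x : R) : R :=
  \sum_(j < J) 2 ^+ j * (2 ^+ j <= x < 2 ^+ j.+1)%R%:R.

Lemma pair_weightP (x : R) : x < 2 ^+ J -> (x != 0 -> 1 <= x) ->
  pair_weight x <= x <= 2 * pair_weight x.
Proof.
move=> xJ x1; have [->|x0] := eqVneq x 0.
  rewrite /pair_weight big1 ?mulr0 ?lexx // => j _.
  have /negbTE -> : ~~ (2 ^+ j <= 0 :> R) by rewrite -ltNge exprn_gt0.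
  by rewrite mulr0.
have {}x1 := x1 x0.
have J0 : (0 < J)%N by case: J xJ => // xJ; move: x1; rewrite leNgt -(expr0 2) xJ.
have exj : exists j, x < 2 ^+ j.+1 by exists J.-1; rewrite prednK.
case: (ex_minnP exj) => j xj jmin.
have jJ : (j < J)%N by rewrite -(prednK J0) ltnS; apply: jmin; rewrite prednK.
have jx : 2 ^+ j <= x.
  case: j {jJ} xj jmin => [|j] xj jmin; first by rewrite expr0.
  by rewrite leNgt; apply/negP => /jmin; rewrite ltnn.
have other (j' : 'I_J) : j' != Ordinal jJ -> (2 ^+ j' <= x < 2 ^+ j'.+1) = false.
  move=> jj; apply/negP => /andP[h1 h2].
  have h3 : 2 ^+ j' < 2 ^+ j.+1 :> R by apply: le_lt_trans xj.
  have h4 : 2 ^+ j < 2 ^+ j'.+1 :> R by apply: le_lt_trans h2.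
  move: h3 h4; rewrite !ltr_eXn2l ?ltr1n // !ltnS => h3 h4.
  by move: jj; rewrite -val_eqE /= eqn_leq h3 h4.
rewrite /pair_weight (bigD1 (Ordinal jJ)) //= big1 ?addr0; last first.
  by move=> j' /other ->; rewrite mulr0.
by rewrite jx xj mulr1 jx -exprS ltW.
Qed.

Definition layer (S : {set 'I_n}) (j : 'I_J) : {set V} := finset.setX S [set j].

(** An edge of class [j] has both ends in copy [j], so a weighted cut is assembled from one
    unweighted cut per layer. *)
Definition layered_cut (f : {set V} -> nat) (S : {set 'I_n}) : R :=
  \sum_(j < J) 2 ^+ j * (f (layer S j))%:R.

Lemma sum_symmetric (F : 'I_n -> 'I_n -> R) :
  (forall u v, F u v = F v u) -> (forall u, F u u = 0) ->
  \sum_u \sum_v F u v = 2 * \sum_(p : 'I_n * 'I_n | (p.1 < p.2)%N) F p.1 p.2.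
Proof.
move=> Fs F0; rewrite pair_big /= (bigID (fun p : 'I_n * 'I_n => (p.1 < p.2)%N)) /=.
rewrite mulr_natl mulr2n; congr (_ + _).
rewrite (bigID (fun p : 'I_n * 'I_n => (p.2 < p.1)%N)) /= addrC big1 ?add0r; last first.
  move=> [u v] /=; rewrite -!leqNgt -eqn_leq => /eqP/val_inj ->; exact: F0.
pose swap (p : 'I_n * 'I_n) := (p.2, p.1).
rewrite (reindex_inj (inv_inj (_ : involutive swap))) /=; last by case.
apply: eq_big => [[u v]|[u v] _] /=; last exact: Fs.
by case: ltngtP.
Qed.

Lemma card_layered_edges (W : 'M[R]_n) (S : {set 'I_n}) (j : 'I_J) :
  #|cut_edges (class_edges W) (layer S j)|%:R =
  \sum_(p : 'I_n * 'I_n | (p.1 < p.2)%N)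
    ((p.1 \in S) (+) (p.2 \in S))%:R * (2 ^+ j <= W p.1 p.2 < 2 ^+ j.+1)%R%:R :> R.
Proof.
pose h (p : 'I_n * 'I_n) : V * V := ((p.1, j), (p.2, j)).
have h_inj : injective h by move=> [u v] [u' v'] [-> ->].
pose Q := [set p : 'I_n * 'I_n | [&& (p.1 < p.2)%N, (p.1 \in S) (+) (p.2 \in S)
   & 2 ^+ j <= W p.1 p.2 < 2 ^+ j.+1]].
have -> : cut_edges (class_edges W) (layer S j) = [set h p | p in Q].
  apply/finset.setP => -[[u a] [v b]]; apply/idP/imsetP.
    rewrite !inE /crosses !inE /= => /andP[/and3P[/eqP -> uv Wb] cr].
    have bj : b = j by apply/eqP; move: cr; case: (b == j); rewrite ?andbT ?andbF.
    exists (u, v); last by rewrite /h /= bj.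
    by rewrite inE /= uv -bj Wb; move: cr; rewrite bj eqxx !andbT => ->.
  case=> -[u' v']; rewrite inE /= => /and3P[uv cr Wj] [-> -> -> ->].
  by rewrite !inE /crosses !inE /= uv Wj !eqxx !andbT.
rewrite card_imset // -sum1_card natr_sum big_mkcond [RHS]big_mkcond /=.
apply: eq_bigr => p _; rewrite inE; case: (p.1 < p.2)%N => //=.
by case: (_ (+) _) => /=; case: (2 ^+ j <= _ < _); rewrite ?mulr1 ?mulr0 ?mul0r.
Qed.

Lemma layered_cut_bounds (w : R) (W : 'M[R]_n) (S : {set 'I_n}) :
  weighted_graph w W -> w < 2 ^+ J ->
  layered_cut (fun X => #|cut_edges (class_edges W) X|) S <= cut_weight W S <=
  2 * layered_cut (fun X => #|cut_edges (class_edges W) X|) S.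
Proof.
move=> Wg wJ; set q := layered_cut _ _.
pose chi (p : 'I_n * 'I_n) : R := ((p.1 \in S) (+) (p.2 \in S))%:R.
have -> : cut_weight W S = \sum_(p : 'I_n * 'I_n | (p.1 < p.2)%N) chi p * W p.1 p.2.
  have h := cut_weight_indicator Wg S; have two0 : (2 : R) != 0 by rewrite pnatr_eq0.
  apply: (mulfI two0); rewrite -h (@sum_symmetric (fun u v => W u v * ((u \in S)%:R - (v \in S)%:R) ^+ 2)).
  - congr (_ * _); apply: eq_bigr => -[u v] _ /=; rewrite /chi /=.
    by case: (u \in S); case: (v \in S) => /=; ring.
  - by move=> u v; rewrite (weight_sym Wg) -[in RHS]sqrrN opprB.
  - by move=> u; rewrite subrr expr0n mulr0.
have -> : q = \sum_(p : 'I_n * 'I_n | (p.1 < p.2)%N) chi p * pair_weight (W p.1 p.2).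
  rewrite /q /layered_cut; under eq_bigr do rewrite card_layered_edges mulr_sumr.
  rewrite exchange_big /=; apply: eq_bigr => p _.
  by rewrite /pair_weight mulr_sumr; apply: eq_bigr => j _; rewrite /chi mulrCA.
have bnd p : pair_weight (W p.1 p.2) <= W p.1 p.2 <= 2 * pair_weight (W p.1 p.2).
  have [_ _ W1] := Wg; apply: pair_weightP.
    have [->|/W1/andP[_ h]] := eqVneq (W p.1 p.2) 0; first by rewrite exprn_gt0.
    exact: le_lt_trans h wJ.
  by move=> /W1/andP[].
apply/andP; split; last rewrite mulr_sumr.
  apply: ler_sum => p _; apply: ler_wpM2l; first by rewrite /chi.
  by have /andP[] := bnd p.
apply: ler_sum => p _; rewrite mulrCA; apply: ler_wpM2l; first by rewrite /chi.
by have /andP[] := bnd p.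
Qed.

(** * Choosing a partition from approximate cuts *)

Section Choice.
Variables (k : nat) (f : {set V} -> nat) (A0 : {ffun 'I_k -> {set 'I_n}}).

(** Without loops a degree is the cut of a singleton, so volumes too are recovered from cuts. *)
Definition approx_conductance (S : {set 'I_n}) : R :=
  layered_cut f S / \sum_(u in S) layered_cut f [set u].

Definition approx_max_conductance (A : {ffun 'I_k -> {set 'I_n}}) : R :=
  \big[Num.max/0]_(i < k) approx_conductance (A i).

Definition best_partition : {ffun 'I_k -> {set 'I_n}} :=
  [arg min_(A < A0 | kway_partition A) approx_max_conductance A]%O.

Hypothesis A0_part : kway_partition A0.

Lemma best_partition_kway : kway_partition best_partition.
Proof. by rewrite /best_partition; case: arg_minP. Qed.

(** Rounding and sampling keep cuts and volumes between a quarter and twice their values, hence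
    conductances within a factor [8]; it is lost once for each of the two partitions. *)
Lemma best_partition_conductance (w : R) (W : 'M[R]_n) (P : {ffun 'I_k -> {set 'I_n}}) :
  weighted_graph w W -> w < 2 ^+ J -> kway_partition P ->
  (forall X : {set V}, (#|cut_edges (class_edges W) X| <= 2 * f X)%N /\
                 (f X <= 2 * #|cut_edges (class_edges W) X|)%N) ->
  max_conductance W best_partition <= 64 * max_conductance W P.
Proof.
move=> Wg wJ Pp fX.
have cut_bounds S : cut_weight W S <= 4 * layered_cut f S /\ layered_cut f S <= 2 * cut_weight W S.
  have /andP[h1 h2] := layered_cut_bounds S Wg wJ.
  move: h1 h2; set q := layered_cut _ S => h1 h2.
  have h3 : q <= 2 * layered_cut f S.
    rewrite /q /layered_cut mulr_sumr; apply: ler_sum => j _; rewrite mulrCA.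
    by apply: ler_wpM2l; [exact: exprn_ge0 | rewrite -natrM ler_nat; case: (fX (layer S j))].
  have h4 : layered_cut f S <= 2 * q.
    rewrite /q /layered_cut mulr_sumr; apply: ler_sum => j _; rewrite mulrCA.
    by apply: ler_wpM2l; [exact: exprn_ge0 | rewrite -natrM ler_nat; case: (fX (layer S j))].
  split; lra.
have vol_cut S : vol W S = \sum_(u in S) cut_weight W [set u].
  apply: eq_bigr => u _; rewrite /cut_weight big_set1 (bigD1 u) //=.
  have [_ W0 _] := Wg; rewrite W0 add0r; apply: eq_bigl => v; by rewrite !inE.
have c0 S : 0 <= layered_cut f S.
  by apply: sumr_ge0 => j _; rewrite mulr_ge0 // exprn_ge0.
have cond_bounds S : conductance W S <= 8 * approx_conductance S /\
    approx_conductance S <= 8 * conductance W S.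
  have [b1 b2] := cut_bounds S; rewrite /conductance /approx_conductance -/(cut_weight W S).
  set ev := \sum_(u in S) _.
  have v1 : vol W S <= 4 * ev.
    by rewrite vol_cut /ev mulr_sumr; apply: ler_sum => u _; case: (cut_bounds [set u]).
  have v2 : ev <= 2 * vol W S.
    by rewrite vol_cut /ev mulr_sumr; apply: ler_sum => u _; case: (cut_bounds [set u]).
  have ev0 : 0 <= ev by apply: sumr_ge0.
  have v0 := vol_ge0 Wg S; have cw0 := cut_weight_ge0 Wg S.
  have [evz|evz] := eqVneq ev 0.
    have -> : vol W S = 0 by lra.
    by rewrite evz invr0 !mulr0.
  have evp : 0 < ev by rewrite lt_def evz.
  have vp : 0 < vol W S by lra.
  have c0S := c0 S.
  split.
    rewrite ler_pdivrMr // (_ : 8 * _ * _ = 8 * layered_cut f S * vol W S / ev); last by ring.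
    rewrite ler_pdivlMr //.
    have : cut_weight W S * ev <= 4 * layered_cut f S * (2 * vol W S) by apply: ler_pM.
    by lra.
  rewrite ler_pdivrMr // (_ : 8 * _ * _ = 8 * cut_weight W S * ev / vol W S); last by ring.
  rewrite ler_pdivlMr //.
  have : layered_cut f S * vol W S <= 2 * cut_weight W S * (4 * ev) by apply: ler_pM.
  by lra.
have mono (g h : {set 'I_n} -> R) (A : {ffun 'I_k -> {set 'I_n}}) :
    (forall S, g S <= 8 * h S) ->
    \big[Num.max/0]_(i < k) g (A i) <= 8 * \big[Num.max/0]_(i < k) h (A i).
  move=> gh; apply: bigmax_le => [|i _].
    by rewrite mulr_ge0 // bigmax_ge_id.
  apply: le_trans (gh _) _; apply: ler_wpM2l => //.
  exact: (le_bigmax 0 (fun i => h (A i))).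
apply: (@le_trans _ _ (8 * approx_max_conductance best_partition)).
  by apply: mono => S; case: (cond_bounds S).
have : approx_max_conductance best_partition <= approx_max_conductance P.
  by rewrite /best_partition; case: arg_minP => // A _; apply.
have : approx_max_conductance P <= 8 * max_conductance W P.
  by apply: mono => S; case: (cond_bounds S).
by lra.
Qed.

End Choice.
End WeightClasses.

Lemma kway_partition_exists n k : (0 < k < n)%N ->
  exists A : {ffun 'I_k -> {set 'I_n}}, kway_partition A.
Proof.
case: k => // k /andP[_ kn].
(* The first [k] vertices become singletons and the others form the last of the [k.+1] parts. *)
pose c (u : 'I_n) : 'I_k.+1 := inord (minn u k).
have cE u : nat_of_ord (c u) = minn u k by rewrite /c inordK // ltnS geq_minr.
exists [ffun i => [set u | c u == i]]; apply/and3P; split.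
- apply/forallP => i; rewrite ffunE; apply/set0Pn.
  have iN : (i < n)%N by apply: leq_trans (ltn_ord i) _; apply: ltnW.
  exists (Ordinal iN); rewrite inE; apply/eqP/ord_inj; rewrite cE /=.
  by apply/minn_idPl; rewrite -ltnS.
- apply/forallP => i; apply/forallP => j; apply/implyP => ij; rewrite !ffunE.
  apply/pred0P => u /=; rewrite !inE; case: eqP => //= ->; exact: negbTE.
apply/eqP/finset.setP => u; rewrite inE; apply/bigcupP; exists (c u) => //.
by rewrite ffunE inE.
Qed.

(** * The two protocols *)

Section UniformCoins.
Variables (R : realType) (s M : nat).
Hypothesis M_gt0 : (0 < M)%N.

Definition uniform_coins : private_coins R s.
Proof.
apply: (@PrivateCoins R s 'I_M (fun _ _ => M%:R^-1)).
- by move=> _ _; rewrite invr_ge0.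
- by move=> _; rewrite sumr_const card_ord -[LHS]mulr_natr mulVf // pnatr_eq0 -lt0n.
Defined.

Lemma sum_uniform_outcome (f : 'I_M -> R) :
  \sum_(om : outcome uniform_coins s) outcome_pmf om * f (om None) = M%:R^-1 * \sum_m f m.
Proof.
pose F (p : option 'I_s) (m : 'I_M) : R := M%:R^-1 * (if p == None then f m else 1).
transitivity (\sum_(om : {ffun option 'I_s -> 'I_M}) \prod_p F p (om p)).
  apply: eq_bigr => om _; rewrite /F big_split /=; congr (_ * _).
  rewrite (bigD1 None) //= big1 ?mulr1 // => p /negbTE ->; by [].
rewrite -(bigA_distr_bigA F) (bigD1 None) //= [X in _ * X]big1 ?mulr1.
  by rewrite /F /= -mulr_sumr.
move=> p /negbTE pN; rewrite /F pN -mulr_sumr sumr_const card_ord.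
by rewrite mulVf // pnatr_eq0 -lt0n.
Qed.

End UniformCoins.

(** * Posting edges in the two communication models *)

Section Protocols.
Variables (R : realType) (n s : nat) (Out : Type) (V : finType) (Q M : nat).
Variables (kap : 'I_M -> nat -> pred (V * V)) (edges : 'M[R]_n -> {set V * V}).
Variable decide : seq (seq (V * V)) -> Out.
Variable m0 : 'I_M.
Let M_gt0 : (0 < M)%N := leq_ltn_trans (leq0n m0) (ltn_ord m0).
Let E := (V * V)%type.
Let fresh : seq (seq E) := nseq Q [::].
(** The forests themselves are never sent: every party rebuilds them from the seed and the posted
    edges. *)
Let replay (m : 'I_M) (l : seq E) := foldl (sift (kap m)) fresh l.
Let B := (Q * #|V|)%N.

Definition site_stream (x : 'I_s -> 'M[R]_n) : seq E :=
  flatten [seq enum (edges (x i)) | i <- enum 'I_s].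

Let size_replay m l : (total_size (replay m l) <= B)%N.
Proof.
have fr : all (@forest V) fresh by apply/allP => F /nseqP[->].
have := total_size_le (all_forest_foldl_sift (kap m) l fr).
by rewrite size_foldl_sift size_nseq.
Qed.

Let total_size_fresh : total_size fresh = 0%N.
Proof. by rewrite /total_size /fresh; elim: Q => //= q ->. Qed.

Section Relay.
(** A list of at most [B] edges is padded with [None], so that the relayed state lives in a finite
    type. *)
Let T := ('I_M * {ffun 'I_B -> option E})%type.
Let posted (f : {ffun 'I_B -> option E}) : seq E := pmap id [seq f i | i <- enum 'I_B].
Let pack (l : seq E) : {ffun 'I_B -> option E} := [ffun i : 'I_B => onth l i].

Let packK l : (size l <= B)%N -> posted (pack l) = l.
Proof.
move=> lB; rewrite /posted.
have -> : [seq pack l i | i <- enum 'I_B] = map Some l ++ nseq (B - size l) None.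
  apply: (@eq_from_nth _ None).
    by rewrite size_map size_enum_ord size_cat size_map size_nseq subnKC.
  move=> i; rewrite size_map size_enum_ord => iB.
  rewrite (nth_map (Ordinal iB)) ?size_enum_ord // ffunE nth_enum_ord // nth_cat size_map.
  by have [il|li] := ltnP i (size l); rewrite ?onthE // -onthE onth_default // nth_nseq if_same.
rewrite pmap_cat (_ : pmap id (nseq _ None) = [::]) ?cats0; last by elim: (B - _)%N.
by elim: l {lB} => //= e l ->.
Qed.

Let upd (i : 'I_s) (x : 'M[R]_n) (st : T) : T :=
  (st.1, pack (posted st.2 ++ effective (kap st.1) (replay st.1 (posted st.2)) (enum (edges x)))).

(** As many edges are posted as the forests contain, at most [B]; thus [pack] never truncates. *)
Let upd_correct m x js l : size l = total_size (replay m l) ->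
  exists l', [/\ foldl (fun st j => upd j (x j) st) (m, pack l) js = (m, pack l'),
    replay m l' = foldl (sift (kap m)) (replay m l) (flatten [seq enum (edges (x i)) | i <- js]) &
    size l' = total_size (replay m l')].
Proof.
elim: js l => [|j js IHjs] l sl; first by exists l.
set l2 := l ++ effective (kap m) (replay m l) (enum (edges (x j))).
have r2 : replay m l2 = foldl (sift (kap m)) (replay m l) (enum (edges (x j))).
  by rewrite /replay /l2 foldl_cat foldl_sift_effective.
have s2 : size l2 = total_size (replay m l2).
  by rewrite r2 total_size_effective size_cat sl.
have [l' [h1 h2 h3]] := IHjs _ s2; exists l'; split => //.
  rewrite /= (_ : upd j (x j) (m, pack l) = (m, pack l2)) ?h1 //.
  by rewrite /upd /= packK ?sl ?size_replay.
by rewrite h2 r2 /= foldl_cat.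
Qed.

Definition relay_protocol (N : nat) : mp_protocol R n s Out :=
  @relay R n s Out (uniform_coins R s M_gt0) T N (m0, pack [::])
    (fun m => (m, pack [::])) upd (fun st => decide (replay st.1 (posted st.2))).

Lemma relay_protocolP N x (om : outcome (mp_coins (relay_protocol N)) s) :
  (0 < N)%N -> (M * (#|V| * #|V|).+1 ^ B <= 2 ^ N)%N ->
  mp_output (relay_protocol N) x om = decide (replay (om None) (site_stream x)) /\
  mp_cost (relay_protocol N) x om = (2 * N * s)%N.
Proof.
move=> N0 cardT; have T_le : (#|{: T}| <= 2 ^ N)%N.
  by rewrite card_prod card_ord card_ffun card_ord card_option card_prod.
split; last exact: relay_cost.
rewrite /relay_protocol relay_output //.
have [|l' [-> h2 h3]] := @upd_correct (om None) x (enum 'I_s) [::].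
  by rewrite /= total_size_fresh.
by rewrite /= packK ?h3 ?size_replay // h2.
Qed.

End Relay.

Section Board.
(** A token is the seed, a posted edge, or [inr None], by which a site hands over to the next
    one. *)
Let T := ('I_M + option E)%type.
Let done_count (ts : seq T) : nat := count (pred1 (inr None)) ts.
Let post (tk : T) : option E := if tk is inr o then o else None.
Let posted (ts : seq T) : seq E := pmap post ts.
Let seed (ts : seq T) : 'I_M := if ts is inl m :: _ then m else m0.
Let board_state (ts : seq T) := replay (seed ts) (posted ts).

Let turn (ts : seq T) : option (option 'I_s) :=
  if ts is [::] then Some None else omap Some (insub (done_count ts)).

Let news (m : 'I_M) (Fs : seq (seq E)) (l : seq E) : option E :=
  ohead [seq e <- l | sift (kap m) Fs e != Fs].

Let site_tok (i : 'I_s) (x : 'M[R]_n) (ts : seq T) : T :=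
  inr (news (seed ts) (board_state ts) (enum (edges x))).

Let coord_tok (c : coin (uniform_coins R s M_gt0)) (_ : seq T) : T := inl (c : 'I_M).

Definition board_protocol (N : nat) : bb_protocol R n s Out :=
  @token_board R n s Out (uniform_coins R s M_gt0) T N (inl m0) turn site_tok
    coord_tok (fun ts => decide (board_state ts)) (1 + s + B).

(** Posting [e] and rescanning [l] from its start is harmless: the edges before [e] had no effect
    and still have none, and [e] has no second effect. *)
Let news_some m Fs l e : news m Fs l = Some e ->
  foldl (sift (kap m)) (sift (kap m) Fs e) l = foldl (sift (kap m)) Fs l.
Proof.
elim: l => //= f l IHl; rewrite /news /=; case: eqP => [fs|_] /=.
  by move=> /IHl h; rewrite sift_stable // fs.
by case=> ->; rewrite sift_self.
Qed.

Let news_some_changes m Fs l e : news m Fs l = Some e -> sift (kap m) Fs e != Fs.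
Proof.
elim: l => //= f l IHl; rewrite /news /=; case: eqP => [_|/eqP fs] /=; first exact: IHl.
by case=> <-.
Qed.

Let news_none m Fs l : news m Fs l = None -> foldl (sift (kap m)) Fs l = Fs.
Proof. by elim: l => //= f l IHl; rewrite /news /=; case: eqP => //= -> /IHl. Qed.

Variables (x : 'I_s -> 'M[R]_n) (m : 'I_M).
Let remaining (i : nat) := flatten [seq enum (edges (x j)) | j <- drop i (enum 'I_s)].

(** The last clause measures progress: until all sites are done, each step writes one token. *)
Let good_board (j : nat) (ts : seq T) := [/\
  seed ts = m /\ ts != [::], (done_count ts <= s)%N,
  size ts = (1 + done_count ts + size (posted ts))%N /\
    size (posted ts) = total_size (board_state ts),
  foldl (sift (kap m)) (board_state ts) (remaining (done_count ts)) =
    replay m (site_stream x) &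
  done_count ts = s \/ size ts = j].

Let step (ts : seq T) := match turn ts with
  | None => ts | Some None => rcons ts (inl m) | Some (Some i) => rcons ts (site_tok i (x i) ts) end.

Let good_first : good_board 1 (step [::]).
Proof.
split.
- by [].
- by [].
- by split=> //; exact: esym total_size_fresh.
- by rewrite /remaining /= drop0.
- by right.
Qed.

Let good_step j ts : good_board j ts -> good_board j.+1 (step ts).
Proof.
case=> [[sm ts0]] ds [sz szp] fin stop; rewrite /step.
have -> : turn ts = omap Some (insub (done_count ts)) by case: (ts) ts0.
have [ds'|ds'] := ltnP (done_count ts) s; last first.
  have e : done_count ts = s by apply/eqP; rewrite eqn_leq ds.
  rewrite insubF ?ltnNge ?ds' //=; split=> //; by left.
have -> : insub (done_count ts) = Some (Ordinal ds') by apply: insubT.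
set i := Ordinal ds' => /=.
have szj : size ts = j by case: stop => // e; have := ds'; rewrite e ltnn.
set o := news (seed ts) (board_state ts) (enum (edges (x i))).
have seedE tk : seed (rcons ts tk) = m by rewrite -sm; case: (ts) ts0.
have ts1 tk : rcons ts tk != [::] by case: (ts).
have postE o' : posted (rcons ts (inr o')) = posted ts ++ (if o' is Some e then [:: e] else [::]).
  by rewrite /posted -cats1 pmap_cat /=; case: o'.
have doneE o' : done_count (rcons ts (inr o')) = (done_count ts + (o' == None))%N.
  by rewrite /done_count -cats1 count_cat /= addn0; case: o'.
have stateE o' : board_state (rcons ts (inr o')) =
    if o' is Some e then sift (kap m) (board_state ts) e else board_state ts.
  rewrite /board_state seedE postE sm /replay; case: o' => [e|]; last by rewrite cats0.
  by rewrite foldl_cat.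
have remE : remaining (done_count ts) = enum (edges (x i)) ++ remaining (done_count ts).+1.
  have nthi : nth i (enum 'I_s) (done_count ts) = i by exact: (nth_ord_enum i i).
  by rewrite /remaining (drop_nth i) ?size_enum_ord //= nthi.
rewrite /site_tok -/o; split; rewrite ?seedE ?doneE ?stateE ?postE //.
- by case: (o == None); rewrite ?addn1 ?addn0.
- rewrite size_rcons size_cat sz; case oE: o => [e|] /=; last by rewrite -szp; split; lia.
  have := news_some_changes oE; rewrite sm => /total_size_sift ->.
  by rewrite -szp; split; lia.
- rewrite -fin; case oE: o => [e|] /=.
    rewrite addn0 remE !foldl_cat; congr foldl.
    by rewrite -sm; apply: news_some.
  rewrite addn1 remE foldl_cat; congr foldl.
  by rewrite -sm; apply/esym/news_none.
- by right; rewrite size_rcons szj.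
Qed.

Let final_board : let ts := iter (1 + s + B) step [::] in
  board_state ts = replay m (site_stream x) /\ (size ts <= 1 + s + B)%N.
Proof.
move=> ts.
have good j : good_board j.+1 (iter j.+1 step [::]).
  by elim: j => [|j IHj]; [exact: good_first | rewrite iterS; apply: good_step].
have := good (s + B)%N; rewrite -/ts -[(s + B).+1]/(1 + s + B)%N -/ts.
case=> [[sm ts0]] ds [sz szp] fin stop.
have pB : (size (posted ts) <= B)%N by rewrite szp size_replay.
(* A board of [1 + s + B] tokens has one seed and at most [B] edges, so at least [s] tokens are
   handovers. *)
have e : done_count ts = s.
  by case: stop => // e; move: sz ds; rewrite e; lia.
split; last by rewrite sz e -addnA leq_add2l leq_add2l.
by move: fin; rewrite e /remaining drop_oversize // size_enum_ord.
Qed.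

Lemma board_protocolP N (om : outcome (bb_coins (board_protocol N)) s) :
  m = om None -> (0 < N)%N -> (M + (#|V| * #|V|).+1 <= 2 ^ N)%N ->
  bb_output (board_protocol N) x om = decide (replay m (site_stream x)) /\
  (bb_cost (board_protocol N) x om <= N * (1 + s + B))%N.
Proof.
move=> mE N0 cardT; have T_le : (#|{: T}| <= 2 ^ N)%N.
  by rewrite card_sum card_ord card_option card_prod.
rewrite /board_protocol token_board_output // token_board_cost //.
have stepE : token_step turn site_tok coord_tok x om =1 step.
  by move=> ts; rewrite /token_step /step mE.
have iterE j : iter j (token_step turn site_tok coord_tok x om) [::] = iter j step [::].
  by apply: eq_iter.
rewrite !iterE; have [h1 h2] := final_board.
by rewrite h1 leq_mul2l h2 orbT.
Qed.

End Board.
End Protocols.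

(** * Size of the protocols *)

Lemma placement_pmf_ge0 (R : realType) (n s : nat) (r : 'I_n * 'I_n -> R) (W : 'M[R]_n)
    (D : placement n s) :
  (forall e, 0 <= r e <= 1) -> 0 <= placement_pmf r W D.
Proof.
move=> r01; rewrite /placement_pmf; case: ifP => // _.
apply: prodr_ge0 => i _; apply: prodr_ge0 => e _.
by have /andP[h1 h2] := r01 e; case: ifP; rewrite ?subr_ge0.
Qed.

(** For each covering placement a uniform seed fails with probability at most [1 / n]; the bound is
    then averaged over placements. *)
Lemma Pr_ge_of_good_seeds (R : realType) (n s M : nat) (M_gt0 : (0 < M)%N)
    (r : 'I_n * 'I_n -> R) (W : 'M[R]_n)
    (close : placement n s -> outcome (uniform_coins R s M_gt0) s -> bool)
    (good : placement n s -> 'I_M -> bool) :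
  (0 < n)%N -> (forall e, 0 <= r e <= 1) ->
  (forall D (om : outcome (uniform_coins R s M_gt0) s),
     covers W D -> good D (om None) -> close D om) ->
  (forall D : placement n s, (n * \sum_m ~~ good D m <= M)%N) ->
  (1 - n%:R `^ (- 1)) * Pr r W (C := uniform_coins R s M_gt0) (fun D _ => covers W D) <=
  Pr r W (fun D om => covers W D && close D om).
Proof.
move=> n0 r01 goodP badM.
have nr : 0 < n%:R :> R by rewrite ltr0n.
have Mr : 0 < M%:R :> R by rewrite ltr0n.
have -> : n%:R `^ (- 1) = n%:R^-1 :> R by rewrite powRN powRr1 // ltW.
rewrite /Pr mulr_sumr; apply: ler_sum => D _.
have p0 := placement_pmf_ge0 W D r01.
under eq_bigr do rewrite -mulrA.
under [X in _ <= X]eq_bigr do rewrite -mulrA.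
rewrite -!mulr_sumr mulrCA; apply: ler_wpM2l => //.
case: (boolP (covers W D)) => cov; last first.
  by rewrite !big1 ?mulr0 // => om _; rewrite mulr0.
rewrite (@sum_uniform_outcome R s M M_gt0 (fun _ : 'I_M => 1)) sumr_const card_ord mulVf ?gt_eqF // mulr1.
apply: (@le_trans _ _ (\sum_(om : outcome (uniform_coins R s M_gt0) s)
   outcome_pmf om * (good D (om None))%:R)).
  rewrite (@sum_uniform_outcome R s M M_gt0 (fun m : 'I_M => (good D m)%:R)).
  rewrite -(ler_pM2l Mr) mulrA divff ?gt_eqF // mul1r.
  have -> : \sum_m (good D m)%:R = M%:R - (\sum_m ~~ good D m)%:R :> R.
    have -> : M%:R = \sum_(m < M) 1 :> R by rewrite sumr_const card_ord.
    rewrite natr_sum -sumrB.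
    by apply: eq_bigr => m _; case: (good D m); rewrite ?subr0 ?subrr.
  rewrite mulrBr mulr1 lerD2l lerN2 ler_pdivlMr // -natrM ler_nat mulnC.
  exact: badM.
apply: ler_sum => om _; apply: ler_wpM2l.
  by apply: prodr_ge0 => p _; apply: coin_pmf_ge0.
rewrite ler_nat; case: (boolP (good D (om None))) => // g.
by rewrite goodP.
Qed.

Section ProtocolSize.
Local Open Scope nat_scope.
Variables (d n s l : nat).
Hypotheses (n_gt0 : 0 < n) (l_gt0 : 0 < l) (ns_lt : n + s < 2 ^ l).

(** The layered graph has at most [2 ^ X] vertices and [2 ^ a] ordered pairs; [N] exceeds the binary
    logarithm of the number of inputs, and [slots] counts the forests. A relayed message holds a
    seed and up to [slots * vertices] edges, a board token only a seed or an edge. *)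
Let X := d.+1 * l.
Let J := (d * l).+1.
Let vertices := n * J.
Let pairs := vertices * vertices.
Let a := 2 * X.
Let L := a.+2.
Let tau := 10 * a + 20.
Let q := 2 ^ l.+1.
Let N := (pairs * s).+1.
Let slots := L * (8 * L ^ 2 * tau).
Let mp_bits := a + 2 * l + 1 + a.+1 * (slots * vertices).
Let bb_bits := a + 2 * l + 2.

Lemma vertices_le : vertices <= 2 ^ X.
Proof.
rewrite /vertices /X mulSn expnD; apply: leq_mul; last by apply: ltn_expl.
by apply: ltnW; apply: leq_ltn_trans ns_lt; apply: leq_addr.
Qed.

Lemma pairs_le : pairs <= 2 ^ a.
Proof. by rewrite /a mul2n -addnn expnD; apply: leq_mul; apply: vertices_le. Qed.

Lemma pairs_lt_levels : 2 * pairs < 2 ^ L.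
Proof.
apply: leq_ltn_trans (_ : 2 * 2 ^ a < _); first by rewrite leq_mul2l pairs_le.
by rewrite -expnS ltn_exp2l.
Qed.

(** Bounding each factor by a power of two, the exponents add up to exactly [10 * a + 20]. *)
Lemma tau_large : 64 * L ^ 3 * tau * vertices * q <= 2 ^ tau.
Proof.
have hL : L ^ 3 <= 2 ^ (3 * a.+1).
  by rewrite mulnC expnM leq_exp2r //; apply: ltn_expl.
have ht : tau <= 2 ^ (5 * a + 10).
  have -> : tau = 2 * (5 * a + 10) by rewrite /tau; lia.
  by rewrite -[5 * a + 10]prednK ?addn_gt0 ?orbT // expnS leq_mul2l /=; apply: ltn_expl.
have hq : q <= 2 ^ a.+1.
  rewrite leq_exp2l // ltnS /a /X; nia.
have hv : vertices <= 2 ^ a.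
  by apply: leq_trans vertices_le _; rewrite leq_exp2l // /a leq_pmull.
apply: leq_trans (_ : 2 ^ 6 * 2 ^ (3 * a.+1) * 2 ^ (5 * a + 10) * 2 ^ a * 2 ^ a.+1 <= _).
  by rewrite !leq_mul.
rewrite -!expnD leq_exp2l // /tau; lia.
Qed.

Lemma seeds_le : q * N <= 2 ^ (a + 2 * l + 1).
Proof.
have hN : N <= 2 ^ a * 2 ^ l.
  apply: leq_trans (_ : 2 ^ a * s.+1 <= _).
    rewrite /N mulnS -addn1 addnC leq_add ?expn_gt0 //.
    by rewrite leq_mul2r pairs_le orbT.
  by rewrite leq_mul2l (leq_trans _ ns_lt) ?orbT // ltnS -[s]add0n leq_add2r.
apply: leq_trans (_ : 2 ^ l.+1 * (2 ^ a * 2 ^ l) <= _); first by rewrite leq_mul2l hN orbT.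
by rewrite -!expnD leq_exp2l //; lia.
Qed.

Lemma mp_bits_enough : q * N * pairs.+1 ^ (slots * vertices) <= 2 ^ mp_bits.
Proof.
rewrite /mp_bits expnD; apply: leq_mul; first exact: seeds_le.
case: (slots * vertices) => [|m]; first by rewrite muln0.
rewrite [X in _ <= X]expnM leq_exp2r //.
by rewrite expnS; apply: leq_trans (_ : 2 ^ a + 2 ^ a <= _);
  [rewrite -addn1 leq_add ?pairs_le ?expn_gt0 | lia].
Qed.

Lemma bb_bits_enough : q * N + pairs.+1 <= 2 ^ bb_bits.
Proof.
have -> : bb_bits = (a + 2 * l + 1).+1 by rewrite /bb_bits; lia.
rewrite expnS mul2n -addnn leq_add ?seeds_le //.
rewrite addn1 expnS; apply: leq_trans (_ : 2 ^ a + 2 ^ a <= _).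
  by rewrite -addn1 leq_add ?pairs_le ?expn_gt0.
by rewrite addnn mul2n leq_double leq_exp2l // leq_addr.
Qed.

Let X_gt0 : 0 < X. Proof. by rewrite muln_gt0. Qed.

Let l_le : l <= X. Proof. exact: leq_pmull. Qed.

Let Y := 40 * X.

Let Y_gt0 : 0 < Y. Proof. by rewrite muln_gt0. Qed.

Let board_le : slots * vertices <= n * Y ^ 5.
Proof.
have hJ : J <= Y by apply: leq_trans (_ : X <= _); [rewrite /J /X; nia | exact: leq_pmull].
have hL : L <= 4 * X by rewrite /L /a; lia.
have ht : tau <= Y by rewrite /tau /a /Y; lia.
have hL2 : 8 * L ^ 2 <= Y ^ 2.
  apply: leq_trans (_ : 8 * (4 * X) ^ 2 <= _); first by rewrite leq_mul2l leq_exp2r.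
  by rewrite /Y !expnMn mulnA leq_mul2r; apply/orP; right.
apply: leq_trans (_ : Y * (Y ^ 2 * Y) * (n * Y) <= _).
  apply: leq_mul; last by rewrite leq_mul2l hJ orbT.
  apply: leq_mul; last exact: leq_mul.
  by apply: leq_trans hL _; rewrite leq_mul2r orbT.
by rewrite leq_eqVlt; apply/orP; left; apply/eqP; rewrite !expnS; ring.
Qed.

Lemma mp_cost_le : 2 * mp_bits * s <= 4 * (40 * X) ^ 6 * (n * s).
Proof.
rewrite -/Y mulnA leq_mul2r; apply/orP; right.
have h1 : a + 2 * l + 1 <= n * Y ^ 6.
  apply: leq_trans (_ : Y <= _); first by rewrite /a /Y; lia.
  by rewrite expnS mulnCA leq_pmulr // muln_gt0 n_gt0 expn_gt0 Y_gt0.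
have h2 : a.+1 * (slots * vertices) <= n * Y ^ 6.
  apply: leq_trans (_ : Y * (n * Y ^ 5) <= _); first by apply: leq_mul => //; rewrite /a /Y; lia.
  by rewrite mulnCA -expnS.
apply: leq_trans (_ : 2 * (n * Y ^ 6 + n * Y ^ 6) <= _); first by rewrite leq_mul2l leq_add.
by rewrite leq_eqVlt; apply/orP; left; apply/eqP; ring.
Qed.

Lemma bb_cost_le : bb_bits * (1 + s + slots * vertices) <= 4 * (40 * X) ^ 6 * (n + s).
Proof.
rewrite -/Y.
have h1 : 1 + s + slots * vertices <= 2 * (Y ^ 5 * (n + s)).
  apply: leq_trans (_ : (n + s) + n * Y ^ 5 <= _); first by rewrite leq_add // leq_add2r.
  have h2 : n + s <= Y ^ 5 * (n + s) by apply: leq_pmull; rewrite expn_gt0 Y_gt0.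
  have h3 : n * Y ^ 5 <= Y ^ 5 * (n + s) by rewrite mulnC leq_mul2l leq_addr orbT.
  by rewrite mul2n -addnn leq_add.
have h2 : bb_bits <= 2 * Y by rewrite /bb_bits /a /Y; lia.
apply: leq_trans (leq_mul h2 h1) _.
by rewrite leq_eqVlt; apply/orP; left; apply/eqP; rewrite !expnS; ring.
Qed.

End ProtocolSize.

(** Since [ln 2] is at least [2^-1], both [trunc_log 2 m] and [1] are at most [2 * ln m]. *)
Lemma log_le_ln (R : realType) (m : nat) : (1 < m)%N ->
  (trunc_log 2 m).+1%:R <= 4 * ln m%:R :> R.
Proof.
move=> m1; have m0 : 0 < m%:R :> R by rewrite ltr0n ltnW.
have ln2 : 2^-1 <= ln 2 :> R.
  rewrite -[leLHS]expRK ler_ln ?posrE ?expR_gt0 //.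
  by apply: le_trans (expR_le_quadratic _) _; lra.
have lnm : ln 2 <= ln m%:R :> R by rewrite ler_ln ?posrE // ler_nat.
have h : (trunc_log 2 m)%:R * ln 2 <= ln m%:R :> R.
  rewrite mulr_natl -lnXn // ler_ln ?posrE ?exprn_gt0 // -natrX ler_nat trunc_logP //.
  exact: ltnW.
have : (trunc_log 2 m)%:R * 2^-1 <= (trunc_log 2 m)%:R * ln 2 :> R by apply: ler_wpM2l.
have -> : (trunc_log 2 m).+1%:R = (trunc_log 2 m)%:R + 1 :> R by rewrite natr1.
lra.
Qed.

(** * Assembly of the two protocols *)

Lemma set_site_stream (R : realType) (n s J : nat) (W : 'M[R]_n) (D : placement n s) :
  covers W D ->
  [set e in site_stream (@class_edges R n J) (local_graph W D)] = class_edges J W.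
Proof.
move=> cov; apply/finset.setP => e; rewrite inE (class_edges_covers cov).
apply/flatten_mapP/existsP => [[i _]|[i ei]]; first by rewrite mem_enum; exists i.
by exists i; rewrite mem_enum.
Qed.

Lemma good_seed_close (R : realType) (n s k J t : nat) (w : R) (W : 'M[R]_n) (D : placement n s)
    (A0 P : {ffun 'I_k -> {set 'I_n}}) (Fs : seq (seq (('I_n * 'I_J) * ('I_n * 'I_J)))) :
  weighted_graph w W -> w < 2 ^+ J -> (0 < k < n)%N -> kway_partition A0 ->
  ((32 * 64 * k%:R ^+ 3)%:E <= upsilon W k)%E -> optimal_partition W P -> covers W D ->
  estimate_good t Fs [set e in site_stream (@class_edges R n J) (local_graph W D)] ->
  close_partition W (32 * 64) (best_partition R (estimate t Fs) A0) P.
Proof.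
move=> Wg wJ kn A0p ups Popt cov; rewrite set_site_stream // => /forallP good.
apply: (close_partition_of_conductance Wg) => //.
- exact: best_partition_kway.
- by rewrite ler1n.
apply: (best_partition_conductance A0p Wg wJ); first by case: Popt.
by move=> S; have /andP[] := good S.
Qed.

Theorem theorem4 (R : realType) :
  exists C C' c : R, [/\ 0 < C, 0 < C' & 0 < c] /\
  forall d : nat, exists (K : R) (b : nat), 0 < K /\
  forall (n s k : nat) (w : R) (r : 'I_n * 'I_n -> R),
    (0 < k < n)%N -> (0 < s)%N -> w <= n%:R ^+ d ->
    (forall e, 0 <= r e <= 1) ->
    (exists pi : mp_protocol R n s {ffun 'I_k -> {set 'I_n}},
      (forall (W : 'M[R]_n) (D : placement n s) (om : outcome (mp_coins pi) s),
         weighted_graph w W -> covers W D ->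
         kway_partition (mp_output pi (local_graph W D) om) /\
         (mp_cost pi (local_graph W D) om)%:R
           <= K * (n%:R * s%:R) * ln (n + s)%:R ^+ b) /\
      (forall (W : 'M[R]_n) (P : {ffun 'I_k -> {set 'I_n}}),
         weighted_graph w W ->
         ((C * k%:R ^+ 3)%:E <= upsilon W k)%E ->
         optimal_partition W P ->
         (1 - n%:R `^ (- c)) * Pr r W (C := mp_coins pi) (fun D _ => covers W D)
         <= Pr r W (fun D om => covers W D &&
              close_partition W C' (mp_output pi (local_graph W D) om) P)))
    /\
    (exists pi : bb_protocol R n s {ffun 'I_k -> {set 'I_n}},
      (forall (W : 'M[R]_n) (D : placement n s) (om : outcome (bb_coins pi) s),
         weighted_graph w W -> covers W D ->
         kway_partition (bb_output pi (local_graph W D) om) /\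
         (bb_cost pi (local_graph W D) om)%:R
           <= K * (n%:R + s%:R) * ln (n + s)%:R ^+ b) /\
      (forall (W : 'M[R]_n) (P : {ffun 'I_k -> {set 'I_n}}),
         weighted_graph w W ->
         ((C * k%:R ^+ 3)%:E <= upsilon W k)%E ->
         optimal_partition W P ->
         (1 - n%:R `^ (- c)) * Pr r W (C := bb_coins pi) (fun D _ => covers W D)
         <= Pr r W (fun D om => covers W D &&
              close_partition W C' (bb_output pi (local_graph W D) om) P))).
Proof.
(* [64] is the loss of [best_partition_conductance] and [32] the constant of
   [close_partition_of_conductance]; exponent [1] stands for failure probability [1 / n]. *)
exists (32 * 64), (32 * 64), 1; split; first by rewrite !mulr_gt0.
(* The costs are at most [4 * (40 * X) ^ 6] times [n * s] or [n + s], where [X = d.+1 * l] and [l]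
   is at most [4 * ln (n + s)]. *)
move=> d; exists (4 * (160 * d.+1%:R) ^+ 6), 6; split.
  by rewrite mulr_gt0 // exprn_gt0 // mulr_gt0.
move=> n s k w r kn s0 wn r01.
have n0 : (0 < n)%N by case/andP: kn => k0 /(ltn_trans k0).
pose l := (trunc_log 2 (n + s)).+1.
have ns_lt : (n + s < 2 ^ l)%N by apply: trunc_log_ltn.
pose X := (d.+1 * l)%N; pose J := (d * l).+1; pose a := (2 * X)%N; pose L := a.+2.
pose tau := (10 * a + 20)%N; pose q := (2 ^ l.+1)%N; pose t := (8 * L ^ 2 * tau)%N.
pose V := ('I_n * 'I_J)%type.
have cardV : #|{: V}| = (n * J)%N by rewrite card_prod !card_ord.
have cardVV : #|{: V * V}| = (n * J * (n * J))%N by rewrite card_prod cardV.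
pose N := (n * J * (n * J) * s).+1; pose M := (q * N)%N.
have lnX : ((40 * X) ^ 6)%:R <= (40 * (d.+1%:R * (4 * ln (n + s)%:R))) ^+ 6 :> R.
  rewrite natrX; apply: lerXn2r; rewrite ?nnegrE //.
    by rewrite !mulr_ge0 // ln_ge0 // ler1n addn_gt0 n0.
  rewrite !natrM; do 2!apply: ler_wpM2l => //; apply: log_le_ln.
  by rewrite -(addn1 1) leq_add.
have costE (x : nat) (y : R) : 0 <= y -> (x%:R <= 4 * ((40 * X) ^ 6)%:R * y) ->
    x%:R <= 4 * (160 * d.+1%:R) ^+ 6 * y * ln (n + s)%:R ^+ 6.
  move=> y0 /le_trans; apply; rewrite [leRHS](_ : _ = 4 * (40 * (d.+1%:R * (4 * ln (n + s)%:R))) ^+ 6 * y).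
    by apply: ler_wpM2r => //; apply: ler_wpM2l.
  by rewrite !exprMn; ring.
have wJ : w < 2 ^+ J.
  apply: le_lt_trans wn _; rewrite -!natrX ltr_nat.
  apply: leq_ltn_trans (_ : (2 ^ l) ^ d < _)%N.
    case: (d) => // d'; rewrite leq_exp2r //.
    by apply: ltnW; apply: leq_ltn_trans ns_lt; apply: leq_addr.
  by rewrite -expnM ltn_exp2l // /J mulnC.
have [A0 A0p] := kway_partition_exists kn.
have cardI : (#|{ffun 'I_s -> {set V * V}}| < 2 ^ N)%N.
  by rewrite card_ffun card_ord -cardsT -powersetT card_powerset cardsT cardVV -expnM ltn_exp2l.
(* The inputs are all families of [s] edge sets, so one list of seeds serves every graph and
   placement. *)
pose src (f : {ffun 'I_s -> {set V * V}}) := flatten [seq enum (f i) | i <- enum 'I_s].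
have [||||||Z badZ] := @sparsifier_seeds R V _ src L tau q N _ _ _ _ _ _ cardI => //.
- by rewrite expn_gt0.
- by rewrite cardVV; apply: (pairs_lt_levels d ns_lt).
- by rewrite cardV; apply: (tau_large d n0 _ ns_lt).
rewrite -/t in badZ.
have M0 : (0 < M)%N by rewrite muln_gt0 expn_gt0.
pose m0 : 'I_M := Ordinal M0.
pose kap (m : 'I_M) := level_filter t (Z m).
pose decide (Fs : seq (seq (V * V))) := best_partition R (estimate t Fs) A0 : {ffun 'I_k -> {set 'I_n}}.
pose edges := @class_edges R n J.
pose good W (D : placement n s) (m : 'I_M) :=
  estimate_good t (sifted t (Z m) L (site_stream edges (local_graph W D)))
    [set e in site_stream edges (local_graph W D)].
(* Fewer than [2 * N] of the [q * N] seeds are bad, and [q = 2 ^ l.+1] exceeds [2 * n]. *)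
have badM W (D : placement n s) : (n * \sum_m ~~ good W D m <= M)%N.
  have := badZ [ffun i => edges (local_graph W D i)].
  have -> : src [ffun i => edges (local_graph W D i)] = site_stream edges (local_graph W D).
    by congr flatten; apply: eq_map => i; rewrite ffunE.
  move=> /ltnW h; apply: leq_trans (_ : n * (2 * N) <= _)%N; first exact: leq_mul.
  rewrite mulnA; apply: leq_mul => //; rewrite mulnC /q expnS leq_mul2l /=.
  by apply: ltnW; apply: leq_ltn_trans ns_lt; apply: leq_addr.
split.
  pose bits := (a + 2 * l + 1 + a.+1 * (L * t * (n * J)))%N.
  have bits0 : (0 < bits)%N by rewrite /bits addn1.
  exists (relay_protocol s (L * t) kap edges decide m0 bits).
  have cardT : (M * (#|{: V}| * #|{: V}|).+1 ^ (L * t * #|{: V}|) <= 2 ^ bits)%N.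
    by rewrite cardV; apply: (mp_bits_enough d n0 _ ns_lt).
  have spec x om := @relay_protocolP R n s _ V (L * t) M kap edges decide m0 bits x om bits0 cardT.
  split=> [W D om Wg cov|W P Wg ups Popt].
    have [-> ->] := spec (local_graph W D) om.
    split; first exact: best_partition_kway.
    apply: costE; first exact: mulr_ge0.
    by rewrite -!natrM ler_nat; apply: mp_cost_le.
  apply: (Pr_ge_of_good_seeds (good := good W)) => // D om cov g.
  have [-> _] := spec (local_graph W D) om.
  exact: (good_seed_close Wg wJ kn A0p ups Popt cov g).
pose bits := (a + 2 * l + 2)%N.
have bits0 : (0 < bits)%N by rewrite /bits addn2.
exists (board_protocol s (L * t) kap edges decide m0 bits).
have cardT : (M + (#|{: V}| * #|{: V}|).+1 <= 2 ^ bits)%N.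
  by rewrite cardV; apply: (bb_bits_enough d n0 _ ns_lt).
have spec x om := @board_protocolP R n s _ V (L * t) M kap edges decide m0 x _ bits om erefl bits0 cardT.
split=> [W D om Wg cov|W P Wg ups Popt].
  have [-> cost] := spec (local_graph W D) om.
  split; first exact: best_partition_kway.
  apply: costE; first exact: addr_ge0.
  rewrite -natrD -!natrM ler_nat; apply: leq_trans cost _.
  by rewrite cardV; apply: bb_cost_le.
apply: (Pr_ge_of_good_seeds (good := good W)) => // D om cov g.
have [-> _] := spec (local_graph W D) om.
exact: (good_seed_close Wg wJ kn A0p ups Popt cov g).
Qed.
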